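(* Let $H$ be an $h$-vertex ordered graph and let $\eta>0$. Then for every $\nu_0>0$ there exist $n_0\in\mathbb N$ and $0<\nu\le\nu_0$ so that the following holds. Suppose that $G$ is an $n$-vertex ordered graph, where $n\ge n_0$, with $$\delta(G)\ge\left(1-\frac{1}{\chi_{<}(H)}+\eta\right)n.$$ Then $V(G)=[n]$ contains a set $Abs$ so that \begin{itemize} \item $|Abs|\le\nu n$; \item $Abs$ is an $H$-absorbing set for every $W\subseteq V(G)\setminus Abs$ such that $|W|\in h\mathbb N$ and $|W|\le\nu^3n$. \end{itemize}
   Context: An ordered graph $H$ on $h$ vertices is a graph with vertex set $[h]=\{1,\dots,h\}$ (more generally, a finite graph with a linearly ordered vertex set; induced subgraphs inherit the order). An ordered graph $G$ contains a copy of $H$ if there is an order-preserving injection $\phi:[h]\to V(G)$ with $\phi(i)\phi(j)\in E(G)$ whenever $ij\in E(H)$. An $H$-tiling in $G$ is a collection of vertex-disjoint copies of $H$ in $G$; it is perfect if it covers all vertices of $G$. $\delta(G)$ denotes the minimum degree. The interval chromatic number $\chi_{<}(H)$ is the minimum number of intervals into which $[h]$ can be partitioned so that no two vertices in the same interval are adjacent in $H$. Given an ordered graph $G$, a set $S\subseteq V(G)$ is an $H$-absorbing set for $Q\subseteq V(G)$ if both $G[S]$ and $G[S\cup Q]$ contain perfect $H$-tilings. *)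

(* Defs.v *)
From mathcomp Require Import all_boot.

Set Implicit Arguments.
Unset Strict Implicit.
Unset Printing Implicit Defensive.

(* Vertices are numbered from 0: 'I_n, with its order as numbers, stands for
   the ordered vertex set [n]. *)
Record ordered_graph (n : nat) := OrderedGraph {
  adj :> rel 'I_n;
  adj_sym : symmetric adj;
  adj_irr : irreflexive adj
}.

Definition degree n (G : ordered_graph n) (v : 'I_n) : nat :=
  #|[set w | G v w]|.

(* Degrees are smaller than n, so the default value n of the minimum is only
   reached by the graph without vertices. *)
Definition min_degree n (G : ordered_graph n) : nat :=
  \big[minn/n]_(v : 'I_n) degree G v.

Definition is_interval n (B : {set 'I_n}) : bool :=
  [forall x in B, forall z in B, forall y : 'I_n,
     (x <= y <= z) ==> (y \in B)].

Definition independent n (G : ordered_graph n) (B : {set 'I_n}) : bool :=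
  [forall x in B, forall y in B, ~~ G x y].

Definition interval_coloring n (G : ordered_graph n) (P : {set {set 'I_n}})
    : bool :=
  partition P [set: 'I_n] &&
  [forall B in P, is_interval B && independent G B].

(* The default value n is the number of parts of the partition into
   singletons, which is always an interval coloring. *)
Definition interval_chromatic_number n (G : ordered_graph n) : nat :=
  \big[minn/n]_(P : {set {set 'I_n}} | interval_coloring G P) #|P|.

(* phi is a copy of H in the induced subgraph G[S], i.e. a copy of H in G all
   of whose vertices lie in S. *)
Definition is_copy h (H : ordered_graph h) n (G : ordered_graph n)
    (S : {set 'I_n}) (phi : {ffun 'I_h -> 'I_n}) : Prop :=
  [/\ injective phi,
      {homo phi : i j / i <= j},
      forall i j, H i j -> G (phi i) (phi j)
    & forall i, phi i \in S].

Definition is_tiling h (H : ordered_graph h) n (G : ordered_graph n)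
    (S : {set 'I_n}) (T : {set {ffun 'I_h -> 'I_n}}) : Prop :=
  (forall phi, phi \in T -> is_copy H G S phi) /\
  (forall phi psi, phi \in T -> psi \in T -> phi != psi ->
     [disjoint phi @: 'I_h & psi @: 'I_h]).

Definition has_perfect_tiling h (H : ordered_graph h) n (G : ordered_graph n)
    (S : {set 'I_n}) : Prop :=
  exists T : {set {ffun 'I_h -> 'I_n}},
    is_tiling H G S T /\ \bigcup_(phi in T) (phi @: 'I_h) = S.

Definition absorbing_set h (H : ordered_graph h) n (G : ordered_graph n)
    (S Q : {set 'I_n}) : Prop :=
  has_perfect_tiling H G S /\ has_perfect_tiling H G (S :|: Q).

(* Main.v *)
Require Import Defs.
From mathcomp Require Import all_boot all_order all_fingroup all_algebra reals.
From mathcomp Require Import boolp zify ring lra.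

(** Write r for the interval chromatic number of H; if r = 1 every set whose
    size is a multiple of h is tiled, so let r > 1.

    A clique on r + 1 vertices can be built greedily, with at least a constant
    fraction of all vertices to choose from at every step, and it can be blown
    up by a Fubini argument. In a blow-up with suitable layer sizes, adding one
    vertex to any layer gives a tiled set, because moving the boundary between
    two colour classes of H trades a vertex of one layer for a vertex of the
    next. The same holds for adding a vertex x that is adjacent to r of the
    layers only: x takes the place of a vertex in a copy of H that avoids the
    other layer. Hence, for all but few neighbours p of x, many sets become
    tiled both by adding x and by adding p. Since r > 1, two vertices x and y
    have many common neighbours p, and passing through p shows that many sets
    become tiled both by adding x and by adding y.

    A copy of H together with h such sets, one for each of its vertices paired
    with a vertex of Q, absorbs the h-set Q, so every Q has many absorbers of
    bounded size. A greedy choice of linearly many disjoint absorbers, which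
    decreases an exponential weight over all Q, leaves for every Q more
    absorbers in the family than there are h-sets in a partition of W. *)

Set Implicit Arguments.
Unset Strict Implicit.
Unset Printing Implicit Defensive.

Import Order.TTheory GRing.Theory Num.Theory.

(** * Tilings of layered sets *)

Definition tiled h (H : ordered_graph h) n (G : ordered_graph n)
    (s : seq 'I_n) : Prop := has_perfect_tiling H G [set v in s].

Lemma tiled_eq_mem h (H : ordered_graph h) n (G : ordered_graph n)
    (s t : seq 'I_n) : s =i t -> tiled H G s -> tiled H G t.
Proof.
by move=> st; rewrite /tiled (_ : [set v in t] = [set v in s]) //;
  apply/setP => v; rewrite !inE st.
Qed.

Lemma tiled_nil h (H : ordered_graph h) n (G : ordered_graph n) :
  tiled H G [::].
Proof.
exists set0; split; last by rewrite big_set0; apply/setP => v; rewrite !inE.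
by split=> [phi|phi psi]; rewrite inE.
Qed.

Lemma tiled_cat h (H : ordered_graph h) n (G : ordered_graph n)
    (s t : seq 'I_n) : ~~ has (mem s) t ->
  tiled H G s -> tiled H G t -> tiled H G (s ++ t).
Proof.
move=> st [S [[S1 S2] SE]] [T [[T1 T2] TE]].
have disj phi psi : phi \in S -> psi \in T ->
    [disjoint phi @: 'I_h & psi @: 'I_h].
  move=> pS pT; rewrite disjoint_subset; apply/subsetP => v.
  case/imsetP => i _ ->; rewrite inE; apply/negP => /imsetP [j _ E].
  have [_ _ _ /(_ i)] := S1 _ pS; rewrite inE => vs.
  have [_ _ _ /(_ j)] := T1 _ pT; rewrite inE -E => vt.
  by case/hasP: st; exists (phi i).
exists (S :|: T); split; last first.
  rewrite bigcup_setU SE TE; apply/setP => v; by rewrite !inE mem_cat.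
split=> [phi|phi psi]; rewrite !inE.
  case/orP => [/S1|/T1] [? ? ? HS]; split=> // i; have := HS i;
    by rewrite !inE mem_cat => ->; rewrite ?orbT.
case/orP => p1 /orP [] p2 //; [exact: S2|by move=> _; apply: disj| |exact: T2].
by move=> _; rewrite disjoint_sym; apply: disj.
Qed.

(* A proper vertex colouring of [H] by intervals, listed along ['I_h]. *)
Definition interval_labels h (H : ordered_graph h) (lam : seq nat) : Prop :=
  [/\ size lam = h, sorted leq lam
    & forall i j : 'I_h, H i j -> nth 0 lam i != nth 0 lam j].

(** A complete multipartite ordered graph on the vertices of [z], whose parts follow one another;
    nothing is asked inside a part. *)
Definition layered n (G : ordered_graph n) (z : seq (nat * 'I_n)) : Prop :=
  forall a b, a \in z -> b \in z -> a.1 < b.1 -> (a.2 < b.2) && G a.2 b.2.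

Lemma layered_sub n (G : ordered_graph n) (z z' : seq (nat * 'I_n)) :
  {subset z' <= z} -> layered G z -> layered G z'.
Proof. by move=> sz lz a b /sz az /sz bz; apply: lz. Qed.

(** Sorting [z] by vertices also sorts the labels, which thus come out as [lam]; the [i]-th vertex
    then plays the role of vertex [i] of [H]. *)
Lemma tiled_copy h (H : ordered_graph h) n (G : ordered_graph n)
    (z : seq (nat * 'I_n)) (lam : seq nat) :
  layered G z -> uniq (unzip2 z) -> interval_labels H lam ->
  perm_eq (unzip1 z) lam -> tiled H G (unzip2 z).
Proof.
move=> lz uz [sl ol pl] pz.
case: z lz uz pz => [|z0 z1] lz uz pz; first exact: tiled_nil.
set z := z0 :: z1 in lz uz pz *.
pose leT (a b : nat * 'I_n) := a.2 <= b.2.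
have totT : total leT by move=> a b; apply: leq_total.
have trT : transitive leT by move=> b a c; apply: leq_trans.
set y := sort leT z.
have pyz : perm_eq y z by rewrite perm_sort.
have sy : sorted leT y by apply: sort_sorted.
have uy : uniq (unzip2 y) by rewrite (perm_uniq (perm_map _ pyz)).
have lamE : unzip1 y = lam.
  apply: (sorted_eq leq_trans anti_leq) => //; last first.
    by apply: perm_trans pz; apply: perm_map.
  rewrite sorted_map; apply: (sub_in_sorted (P := mem z)) sy.
    move=> a b az bz /= ab; rewrite leqNgt; apply/negP => /(lz _ _ bz az).
    by rewrite ltnNge [_ <= _]ab.
  by apply/allP => a; rewrite /y mem_sort.
have szy : size y = h by rewrite -sl -lamE size_map.
pose phi := [ffun i : 'I_h => (nth z0 y i).2].
have phiE i : phi i = nth z0.2 (unzip2 y) i.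
  by rewrite ffunE (nth_map z0) // szy.
have phiz (i : 'I_h) : nth z0 y i \in z.
  by rewrite -(perm_mem pyz) mem_nth // szy.
have lamn (i : 'I_h) : (nth z0 y i).1 = nth 0 lam i.
  by rewrite -lamE (nth_map z0) // szy.
have phiS : phi @: 'I_h = [set v in unzip2 z].
  apply/setP => v; rewrite inE -(perm_mem (perm_map snd pyz)).
  apply/imsetP/(nthP z0.2) => [[i _ ->]|[i]].
    by exists i; rewrite ?phiE // size_map szy.
  by rewrite size_map szy => ih <-; exists (Ordinal ih); rewrite ?phiE.
exists [set phi]; split; last by rewrite big_set1.
split=> [_ /set1P ->|f g /set1P -> /set1P ->]; last by rewrite eqxx.
split.
- move=> i j; rewrite !phiE => /eqP; rewrite nth_uniq ?size_map ?szy //.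
  by move/eqP/val_inj.
- move=> i j ij; rewrite !ffunE.
  apply: (sorted_leq_nth trT (fun a => leqnn _) _ sy) => //;
    by rewrite inE szy.
- have wlogH (i j : 'I_h) : nth 0 lam i < nth 0 lam j -> G (phi i) (phi j).
    move=> lij; have := lz _ _ (phiz i) (phiz j).
    by rewrite !lamn lij !ffunE => /(_ isT) /andP [].
  move=> i j /pl; rewrite neq_ltn => /orP [] ?; last rewrite adj_sym;
    exact: wlogH.
by move=> i; rewrite -phiS imset_f.
Qed.

(** The index list behind the permutation of the labels is applied to [z] itself. *)
Lemma perm_map_cat (T1 T2 : eqType) (f : T1 -> T2) (z : seq T1) l1 l2 :
  perm_eq (map f z) (l1 ++ l2) ->
  exists z1 z2, [/\ perm_eq z (z1 ++ z2), map f z1 = l1 & map f z2 = l2].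
Proof.
case: z => [|x0 z'].
  rewrite perm_sym => /perm_nilP /eqP; rewrite -size_eq0 size_cat addn_eq0 !size_eq0.
  by move=> /andP [/eqP -> /eqP ->]; exists [::], [::].
set z := x0 :: z'; rewrite perm_sym => /(perm_iotaP (f x0)) [Is pI E].
pose t := map (nth x0 z) Is.
have tE : map f t = l1 ++ l2.
  rewrite E /t -map_comp; apply/eq_in_map => i.
  rewrite (perm_mem pI) mem_iota size_map /= => iz.
  by rewrite -(nth_map x0 (f x0)).
exists (take (size l1) t), (drop (size l1) t); split.
- rewrite cat_take_drop perm_sym /t -[X in perm_eq _ X](mkseq_nth x0).
  by apply: perm_map; rewrite size_map in pI.
- by rewrite map_take tE take_size_cat.
- by rewrite map_drop tE drop_size_cat.
Qed.

(** Only the number of vertices in each layer matters: copies can be cut off one at a time, with any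
    vertices of the prescribed layers. *)
Lemma tiled_layered h (H : ordered_graph h) n (G : ordered_graph n)
    (z : seq (nat * 'I_n)) (L : seq (seq nat)) :
  layered G z -> uniq (unzip2 z) ->
  (forall lam, lam \in L -> interval_labels H lam) ->
  perm_eq (unzip1 z) (flatten L) -> tiled H G (unzip2 z).
Proof.
elim: L z => [|lam L IH] z lz uz HL /=.
  by move/perm_nilP; case: z lz uz => // *; apply: tiled_nil.
case/perm_map_cat => z1 [z2 [pz E1 E2]].
have uz' : uniq (unzip2 z1 ++ unzip2 z2).
  by rewrite -map_cat -(perm_uniq (perm_map snd pz)).
move: (uz'); rewrite cat_uniq => /and3P [u1 d12 u2].
apply: (@tiled_eq_mem _ _ _ _ (unzip2 z1 ++ unzip2 z2)).
  by move=> v; rewrite -map_cat -(perm_mem (perm_map snd pz)).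
have l1 : layered G z1.
  by apply: layered_sub lz => a; rewrite (perm_mem pz) mem_cat => ->.
have l2 : layered G z2.
  by apply: layered_sub lz => a; rewrite (perm_mem pz) mem_cat orbC => ->.
apply: tiled_cat => //.
  by apply: (tiled_copy l1 u1 (HL lam _)); rewrite ?inE ?eqxx // -E1.
apply: IH => // [l Ll|]; first by apply: HL; rewrite inE Ll orbT.
by rewrite -E2.
Qed.

Lemma interval_labels_bump h (H : ordered_graph h) cl d :
  interval_labels H cl -> interval_labels H (map (bump d) cl).
Proof.
case=> sc oc pc; split; first by rewrite size_map.
  rewrite sorted_map; apply: sub_sorted oc => i j /=; rewrite /bump; lia.
move=> i j /pc; rewrite !(nth_map 0) ?sc //; apply: contra => /eqP.
by move/(can_inj (bumpK d)) ->.
Qed.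

Definition shift (cl : seq nat) s := take s cl ++ map succn (drop s cl).

Lemma nth_shift cl s i : i < size cl ->
  nth 0 (shift cl s) i = nth 0 cl i + (s <= i).
Proof.
move=> ic; rewrite /shift nth_cat size_take_min leq_min.
case: (ltnP i s) => /= [is_|si]; rewrite ?ic ?nth_take ?addn0 //.
have sc : s <= size cl by apply: leq_trans (ltnW ic).
rewrite (minn_idPl sc) (nth_map 0) ?size_drop ?ltn_sub2r //; last exact: leq_ltn_trans ic.
by rewrite nth_drop subnKC // addn1.
Qed.

Lemma size_shift cl s : size (shift cl s) = size cl.
Proof. by rewrite /shift size_cat size_map -size_cat cat_take_drop. Qed.

(** For [i <= j] the shift can only widen the gap between the two colours. *)
Lemma interval_labels_shift h (H : ordered_graph h) cl s :
  interval_labels H cl -> interval_labels H (shift cl s).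
Proof.
case=> sc oc pc; split; first by rewrite size_shift.
  apply/(sortedP 0) => i; rewrite size_shift => ic.
  rewrite !nth_shift ?(ltnW ic) //; have := (sortedP 0 oc) i ic; lia.
move=> i j hij; have := pc i j hij; rewrite !nth_shift ?sc //.
have mono (a b : 'I_h) : a <= b -> nth 0 cl a <= nth 0 cl b.
  by move=> ab; apply: (sorted_leq_nth leq_trans leqnn) => //; rewrite inE sc.
have [ij|ji] := leqP i j; first by have := mono _ _ ij; lia.
by have := mono _ _ (ltnW ji); lia.
Qed.

Lemma shift_succ cl s : s < size cl ->
  perm_eq ((nth 0 cl s).+1 :: shift cl s.+1) (nth 0 cl s :: shift cl s).
Proof.
move=> sc; rewrite /shift (take_nth 0 sc) (drop_nth 0 sc) /= cat_rcons.
rewrite perm_sym.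
apply/seq.permP => p; rewrite /= !count_cat /=; lia.
Qed.

(* Replacing [shift cl (s + 1)] by [shift cl s] for [s] the first vertex of
   colour [j] moves one vertex from layer [j] to layer [j + 1]. *)
Definition stack (cl : seq nat) r a : seq (seq nat) :=
  [seq shift cl (index j cl) | j <- iota 0 a] ++
  [seq shift cl (index j cl).+1 | j <- iota a (r - a)].

(** Telescoping: the moves from layer [j] to layer [j + 1] for all [j < a] together carry one vertex
    from layer 0 to layer [a]. *)
Lemma stack_perm cl r a : (forall j, j < r -> j \in cl) -> a <= r ->
  perm_eq (0 :: flatten (stack cl r a)) (a :: flatten (stack cl r 0)).
Proof.
move=> clr; elim: a => [|a IH] ar //.
have e : iota 0 a.+1 = iota 0 a ++ [:: a] by rewrite -addn1 iotaD.
have := IH (ltnW ar); rewrite /stack -(subnSK ar) e !map_cat !flatten_cat /= cats0.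
have ac := clr a ar.
have := @shift_succ cl (index a cl); rewrite index_mem nth_index // => /(_ ac).
move=> /seq.permP h1 /seq.permP h2; apply/seq.permP => p.
have := h1 p; have := h2 p.
rewrite /= !count_cat /=; lia.
Qed.

Lemma stack_labels h (H : ordered_graph h) cl r a lam :
  interval_labels H cl -> lam \in stack cl r a -> interval_labels H lam.
Proof.
move=> Hc; rewrite mem_cat => /orP [] /mapP [j _ ->];
  exact: interval_labels_shift.
Qed.

(** * Blow-ups of ordered cliques *)

(* [P] holds for [c] and for every sequence obtained from [c] by putting some of
   the vertices [s_a] in the positions [lam_a]. *)
Fixpoint variants n (x0 : 'I_n) (lam : seq nat) (s : seq 'I_n)
    (P : seq 'I_n -> Prop) : seq 'I_n -> Prop :=
  match lam, s with
  | i :: lam', v :: s' =>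
      variants x0 lam' s' (fun c => P c /\ P (set_nth x0 c i v))
  | _, _ => P
  end.

Lemma variants0 n (x0 : 'I_n) lam s P c : variants x0 lam s P c -> P c.
Proof. by elim: lam s P => [|i lam IH] [|v s] P //= /IH []. Qed.

Lemma variants1 n (x0 : 'I_n) lam s P c a :
  size s = size lam -> (a < size lam)%N -> variants x0 lam s P c ->
  P (set_nth x0 c (nth 0%N lam a) (nth x0 s a)).
Proof.
elim: lam s P a => [|i lam IH] [|v s] P [|a] //= [ss].
  by move=> _ /variants0 [].
by move=> al /(IH _ _ _ ss al) [].
Qed.

Lemma variants2 n (x0 : 'I_n) lam s P c a b :
  size s = size lam -> (a < b < size lam)%N -> variants x0 lam s P c ->
  P (set_nth x0 (set_nth x0 c (nth 0%N lam b) (nth x0 s b))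
       (nth 0%N lam a) (nth x0 s a)).
Proof.
elim: lam s P a b => [|i lam IH] [|v s] P a b //=; first by rewrite andbF.
move=> [ss]; case: a b => [|a] [|b] //=; rewrite ltnS.
  by move=> bl /(variants1 ss bl) [].
by move=> ab /(IH _ _ _ _ ss ab) [].
Qed.

(* Whichever of the [r.+1] layers gets one more vertex, the layers can then be
   split into [r.+1] copies (see [tiled_fill]). *)
Definition filling cl r d : seq nat :=
  map (bump d) cl ++ rem 0 (flatten (stack cl r 0)).

Lemma zero_in_stack cl r : 0 < r -> 0 \in cl -> 0 \in flatten (stack cl r 0).
Proof.
case: r => // r _ c0; rewrite /stack /= mem_cat /shift mem_cat.
rewrite -index_mem in c0; rewrite (take_nth 0 c0) mem_rcons inE nth_index.
  by rewrite eqxx.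
by rewrite -index_mem.
Qed.

Lemma size_stack cl r a : a <= r -> size (flatten (stack cl r a)) = r * size cl.
Proof.
move=> ar; rewrite size_flatten /shape /stack map_cat -!map_comp.
rewrite (eq_map (g := fun=> size cl)); last by move=> j; exact: size_shift.
rewrite [X in _ ++ X](eq_map (g := fun=> size cl)); last by move=> j; exact: size_shift.
rewrite -map_cat -[X in iota X (r - a)]add0n -iotaD subnKC //.
rewrite (_ : map _ _ = nseq r (size cl)) ?sumn_nseq 1?mulnC //.
by rewrite -[in RHS](size_iota 0 r); elim: (iota 0 r) => //= b l ->.
Qed.

Lemma size_filling cl r d : 0 < r -> 0 \in cl ->
  size (filling cl r d) = (r.+1 * size cl).-1.
Proof.
move=> r0 c0; have h1 := zero_in_stack r0 c0.
rewrite size_cat size_map size_rem // size_stack // mulSn.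
by move: (h1); rewrite -has_pred1 has_count; case: r r0 {h1} => // r _ _;
  case: cl c0 => //= *; lia.
Qed.

(** A stack that lacks one vertex of layer 0 can be completed by a vertex of any layer [a], because
    [stack_perm] trades the missing 0 for [a]. *)
Lemma rem_stack_perm cl r a : 0 < r -> (forall j, j < r -> j \in cl) -> a <= r ->
  perm_eq (a :: rem 0 (flatten (stack cl r 0))) (flatten (stack cl r a)).
Proof.
move=> r0 clr ar; have /seq.permP h1 := perm_to_rem (zero_in_stack r0 (clr 0 r0)).
have /seq.permP h2 := stack_perm clr ar; apply/seq.permP => p.
by have := h1 p; have := h2 p => /=; lia.
Qed.

(** One copy avoids layer [d]; [p] completes the rest of the filling to the stack for [e]. *)
Lemma tiled_fill h (H : ordered_graph h) n (G : ordered_graph n) cl r d e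
    (z : seq (nat * 'I_n)) p :
  0 < r -> interval_labels H cl -> (forall j, j < r -> j \in cl) ->
  e <= r -> layered G ((e, p) :: z) -> uniq (p :: unzip2 z) ->
  perm_eq (unzip1 z) (filling cl r d) -> tiled H G (p :: unzip2 z).
Proof.
move=> r0 Hc clr er lz uz pz.
apply: (@tiled_layered _ H _ G ((e, p) :: z) (map (bump d) cl :: stack cl r e)) => //.
  move=> lam; rewrite inE => /predU1P [->|]; last exact: stack_labels.
  exact: interval_labels_bump.
have /seq.permP h1 := rem_stack_perm r0 clr er.
move/seq.permP: pz => pz; apply/seq.permP => q.
by have := h1 q; have := pz q; rewrite /= !count_cat /=; lia.
Qed.

(* The new vertex [x] takes the place of a vertex of layer [e] in a copy that
   avoids layer [d]; the vertex that it frees fills up the other copies. *)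
Lemma tiled_fill_avoid h (H : ordered_graph h) n (G : ordered_graph n) cl r d e
    (z : seq (nat * 'I_n)) x :
  0 < r -> interval_labels H cl -> (forall j, (j \in cl) = (j < r)) ->
  d <= r -> e <= r -> e != d -> layered G z -> uniq (x :: unzip2 z) ->
  (forall l v, (l, v) \in z -> l != d ->
     G x v && ((l != e) ==> ((v < x) == (l < e)))) ->
  perm_eq (unzip1 z) (filling cl r d) -> tiled H G (x :: unzip2 z).
Proof.
move=> r0 Hc clE dr er ed lz uz xz pz.
have clr j : j < r -> j \in cl by rewrite clE.
(* Since [e != d], the copy avoiding [d] has a vertex in layer [e] for [x] to replace. *)
have ecl : e \in map (bump d) cl.
  apply/mapP; exists (unbump d e); last by rewrite unbumpK // inE.
  rewrite clE /unbump; lia.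
have h1 := perm_to_rem ecl; have h2 := rem_stack_perm r0 clr er.
have : perm_eq (unzip1 z) (rem e (map (bump d) cl) ++ flatten (stack cl r e)).
  move/seq.permP: h1 => h1; move/seq.permP: h2 => h2; move/seq.permP: pz => pz.
  apply/seq.permP => q; have := h1 q; have := h2 q; have := pz q.
  by rewrite /filling /= !count_cat /=; lia.
case/perm_map_cat => z1 [z2 [pz12 E1 E2]].
have sub1 : {subset z1 <= z} by move=> a; rewrite (perm_mem pz12) mem_cat => ->.
have sub2 : {subset z2 <= z}.
  by move=> a; rewrite (perm_mem pz12) mem_cat orbC => ->.
have pu : perm_eq (x :: unzip2 z) (unzip2 ((e, x) :: z1) ++ unzip2 z2).
  by rewrite /= perm_cons -map_cat; apply: perm_map.
apply: (@tiled_eq_mem _ _ _ _ (unzip2 ((e, x) :: z1) ++ unzip2 z2)).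
  by move=> v; rewrite (perm_mem pu).
move: uz; rewrite (perm_uniq pu) cat_uniq => /and3P [u1 d12 u2].
have l1 : layered G ((e, x) :: z1).
  have z1P l v : (l, v) \in z1 -> G x v && ((l != e) ==> ((v < x) == (l < e))).
    move=> lv; apply: xz; first exact: sub1.
    have : l \in map (bump d) cl.
      apply: (mem_rem (x := e)); rewrite -E1; apply/mapP; by exists (l, v).
    by case/mapP => j _ ->; rewrite eq_sym neq_bump.
  move=> [l v] [l' v']; rewrite !inE => /predU1P [[-> ->]|lv] /predU1P [[-> ->]|lv'] /=.
  - by rewrite ltnn.
  - move=> el; have /andP [xv /implyP h3] := z1P _ _ lv'.
    have /eqP h4 : (v' < x) == (l' < e) by apply: h3; rewrite gtn_eqF.
    rewrite xv andbT ltn_neqAle (leqNgt x) h4 -leqNgt (ltnW el) andbT.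
    by apply: contraTneq xv => /val_inj ->; rewrite adj_irr.
  - move=> el; have /andP [xv /implyP h3] := z1P _ _ lv.
    by rewrite adj_sym xv andbT; rewrite (eqP (h3 _)) ?ltn_eqF.
  - exact: (lz (l, v) (l', v') (sub1 _ lv) (sub1 _ lv')).
apply: tiled_cat => //.
  apply: (tiled_copy l1 u1 (interval_labels_bump d Hc)).
  by rewrite /= (E1 : unzip1 z1 = _) perm_sym.
apply: (tiled_layered (L := stack cl r e)) => //; first exact: layered_sub lz.
  by move=> lam; apply: stack_labels.
by rewrite -E2.
Qed.

(* [rk] ranks the vertices of the clique [c], and [x] can replace [c_q] in the
   ordered clique [c] without [c_r]. *)
Definition clique_pattern r n (G : ordered_graph n) (A : 'I_n -> Prop) (x : 'I_n)
    (rq : {perm 'I_r.+1} * 'I_r.+1) (c : seq 'I_n) : Prop :=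
  [/\ A (nth x c 0),
      forall i j : 'I_r.+1, i != j ->
        G (nth x c i) (nth x c j) &&
        ((nth x c i < nth x c j) == (rq.1 i < rq.1 j)),
      rq.2 < r
    & forall i : 'I_r.+1, i < r -> G x (nth x c i) &&
        ((i != rq.2) ==> ((nth x c i < x) == (rq.1 i < rq.1 rq.2)))].

(** The vertex to replace is the largest of the first [r] clique vertices below [x], or the smallest
    of them if none is below [x]: no other of them separates it from [x]. *)
Lemma clique_pattern_ex r n (G : ordered_graph n) (A : 'I_n -> Prop) (x : 'I_n)
    (c : seq 'I_n) : 0 < r ->
  A (nth x c 0) ->
  (forall i j : 'I_r.+1, i != j -> G (nth x c i) (nth x c j)) ->
  (forall i : 'I_r.+1, i < r -> G x (nth x c i)) ->
  exists rq, clique_pattern (r := r) G A x rq c.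
Proof.
move=> r0 Ac cG xG.
(* The rank of a clique vertex, counted from 0. *)
pose f (i : 'I_r.+1) := #|[set k : 'I_r.+1 | nth x c k < nth x c i]|.
have fr i : f i < r.+1.
  rewrite -[X in _ < X]card_ord -cardsT; apply: proper_card.
  by rewrite properE subsetT; apply/subsetPn; exists i; rewrite !inE ?ltnn.
have c_inj (i j : 'I_r.+1) : i != j -> nth x c i != nth x c j.
  by move=> /cG; apply: contraTneq => ->; rewrite adj_irr.
have f_mono (i j : 'I_r.+1) : nth x c i < nth x c j -> f i < f j.
  move=> ij; apply: proper_card; apply/properP; split.
    by apply/subsetP => k; rewrite !inE => /ltn_trans; apply.
  by exists i; rewrite !inE ?ltnn.
have f_lt (i j : 'I_r.+1) : (nth x c i < nth x c j) = (f i < f j).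
  apply/idP/idP => [/f_mono //|]; rewrite ltnNge => fij.
  rewrite ltn_neqAle; apply/andP; split; last first.
    by rewrite leqNgt; apply: contra fij => /f_mono/ltnW.
  by apply: c_inj; apply: contraNneq fij => ->.
have f_inj : injective (fun i => Ordinal (fr i)).
  move=> i j [] fij; apply/eqP; apply/negPn/negP => /c_inj.
  by rewrite neq_ltn !f_lt fij ltnn.
have [q qr qP] : exists2 q : 'I_r.+1, q < r &
   forall i : 'I_r.+1, i < r -> i != q ->
     (nth x c i < x) = (nth x c i < nth x c q).
  have [/existsP [i0 i0P]|/existsPn none] :=
    boolP [exists i : 'I_r.+1, (i < r) && (nth x c i < x)].
    case: (@arg_maxnP _ i0 (fun i : 'I_r.+1 => (i < r) && (nth x c i < x))
      (fun i => nat_of_ord (nth x c i)) i0P) => q.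
    move=> /andP [qr qx] qmax; exists q => // i ir iq.
    apply/idP/idP => [ix|iltq]; last exact: ltn_trans qx.
    by rewrite ltn_neqAle c_inj //=; apply: qmax; rewrite ir.
  have r0' : (@ord0 r : nat) < r by [].
  case: (@arg_minnP _ ord0 (fun i : 'I_r.+1 => i < r)
    (fun i => nat_of_ord (nth x c i)) r0') => q qr qmin.
  exists q => // i ir iq; have := none i; rewrite ir /= => /negPf ->.
  by apply/esym; rewrite ltnNge qmin.
exists (perm f_inj, q); split=> //= [i j ij|i ir].
  by rewrite !permE /= f_lt eqxx andbT cG.
by rewrite xG //=; apply/implyP => iq; rewrite !permE /= -f_lt qP.
Qed.

(** Layers are numbered by rank, the entries of a clique by position; this passes from the former to
    the latter. *)
Definition unrank r (rk : {perm 'I_r.+1}) (fl : seq nat) : seq nat :=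
  [seq rk^-1%g (inord a) : nat | a <- fl].

Lemma unrank_lt r (rk : {perm 'I_r.+1}) fl :
  all (fun a => a < r.+1) (unrank rk fl).
Proof. by apply/allP => a /mapP [b _ ->]. Qed.

(** Any two vertices of [s] with different labels occur together in one variant of [c], which is
    again an ordered clique with the same ranks. For the relation to [x], variants with a single new
    vertex are enough. *)
Lemma clique_pattern_layered r n (G : ordered_graph n) (A : 'I_n -> Prop)
    (x : 'I_n) (rk : {perm 'I_r.+1}) (q : 'I_r.+1) (c s : seq 'I_n) fl :
  all (fun a => a < r.+1) fl -> size s = size fl ->
  variants x (unrank rk fl) s (clique_pattern G A x (rk, q)) c ->
  layered G (zip fl s) /\
  forall l v, (l, v) \in zip fl s -> l != rk ord_max ->
    G x v && ((l != rk q) ==> ((v < x) == (l < rk q))).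
Proof.
move=> fr ss vs; set lam := unrank rk fl in vs.
have szl : size s = size lam by rewrite size_map.
pose I a : 'I_r.+1 := rk^-1%g (inord (nth 0 fl a)).
have IE a : a < size lam -> nth 0 lam a = I a :> nat.
  by move=> al; rewrite (nth_map 0) // -ss szl.
have rkI a : a < size lam -> rk (I a) = nth 0 fl a :> nat.
  move=> al; rewrite permKV inordK // (allP fr) // mem_nth //.
  by rewrite -ss szl.
have F1 a : a < size lam ->
    clique_pattern G A x (rk, q) (set_nth x c (I a) (nth x s a)).
  by move=> al; rewrite -IE //; apply: variants1 vs.
have F2 a b : a < b < size lam -> clique_pattern G A x (rk, q)
    (set_nth x (set_nth x c (I b) (nth x s b)) (I a) (nth x s a)).
  case/andP=> ab bl; rewrite -!IE // ?(ltn_trans ab bl) //.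
  by apply: variants2 vs => //; rewrite ab.
have zP w : w \in zip fl s ->
    exists2 a, a < size lam & w = (rk (I a) : nat, nth x s a).
  move=> /(nthP (0, x)) [a]; rewrite size_zip -ss minnn szl => al <-.
  by exists a => //; rewrite nth_zip ?rkI.
split.
  move=> u v /zP [a al ->] /zP [b bl ->] /= ab.
  have neq : I a != I b by apply: contraTneq ab => ->; rewrite ltnn.
  case: (ltngtP a b) => [lt|lt|E]; last by rewrite E ltnn in ab.
    have [//|_ /(_ _ _ neq) + _ _] := F2 a b _; first by rewrite lt.
    rewrite !nth_set_nth /= !nth_set_nth /= !eqxx val_eqE eq_sym (negPf neq) ab.
    by move=> /andP [-> /eqP ->].
  have [//|_ /(_ _ _ neq) + _ _] := F2 b a _; first by rewrite lt.
  rewrite !nth_set_nth /= !nth_set_nth /= !eqxx val_eqE (negPf neq) ab.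
  by move=> /andP [-> /eqP ->].
move=> l v /zP [a al [-> ->]]; rewrite !val_eqE !(inj_eq perm_inj) => Iar.
have [_ _ _ /(_ (I a))] := F1 a al.
rewrite nth_set_nth /= eqxx; apply.
by rewrite ltn_neqAle -ltnS ltn_ord andbT; move: Iar; rewrite -val_eqE.
Qed.

Lemma filling_lt cl r d : (forall j, (j \in cl) = (j < r)) ->
  all (fun a => a < r.+1) (filling cl r d).
Proof.
move=> clE; apply/allP => a; rewrite mem_cat => /orP [/mapP [j]|/mem_rem].
  by rewrite clE => jr ->; rewrite /bump; lia.
case/flattenP => l; rewrite mem_cat => /orP [] /mapP [j _ ->];
  rewrite mem_cat => /orP []; first 1 last; try (by case/mapP => k /mem_drop;
  rewrite clE => kr ->); by move/mem_take; rewrite clE => /ltnW.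
Qed.

(** The filling is built for the layer of [c_r], to which [x] need not be adjacent. Then [x] enters
    in the layer of [c_q], and [p], a variant of [c_0] and hence in [A], in that of [c_0]. *)
Lemma clique_pattern_switch h (H : ordered_graph h) n (G : ordered_graph n) cl r
    (A : 'I_n -> Prop) (x : 'I_n) (rk : {perm 'I_r.+1}) (q : 'I_r.+1)
    (c : seq 'I_n) p (s : seq 'I_n) :
  0 < r -> interval_labels H cl -> (forall j, (j \in cl) = (j < r)) ->
  size s = size (filling cl r (rk ord_max)) -> uniq (p :: s) -> x \notin s ->
  variants x (unrank rk ((rk ord0 : nat) :: filling cl r (rk ord_max))) (p :: s)
    (clique_pattern G A x (rk, q)) c ->
  [/\ A p, tiled H G (x :: s) & tiled H G (p :: s)].
Proof.
move=> r0 Hc clE ss us xs vs; set d := rk ord_max in ss vs.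
have fr := filling_lt d clE.
have [||lz xz] := clique_pattern_layered _ _ vs; rewrite /= ?ss ?ltn_ord //.
move: lz xz => /= lz xz; pose z' := zip (filling cl r d) s.
have z1 : unzip1 z' = filling cl r d by rewrite unzip1_zip // ss.
have z2 : unzip2 z' = s by rewrite unzip2_zip // ss.
have uz : uniq (p :: unzip2 z') by rewrite z2.
split.
- have [//|//|+ _ _ _] := variants1 (a := 0) _ _ vs; first by rewrite /= size_map ss.
  by rewrite nth_set_nth /= inord_val permK /=.
(* The bound [q < r] makes the layer of [c_q] differ from the avoided layer [d]. *)
- have [_ _ qr _] := variants0 vs; rewrite -z2.
  apply: (@tiled_fill_avoid _ _ _ _ cl r d (rk q)) => //; rewrite ?z1 //.
  + by rewrite -ltnS.
  + by rewrite -ltnS.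
  + by rewrite /d val_eqE (inj_eq perm_inj) -val_eqE /= ltn_eqF.
  + by apply: layered_sub lz => w; rewrite inE orbC => ->.
  + by rewrite z2 /= xs; case/andP: us.
  by move=> l v lv; apply: xz; rewrite inE lv orbT.
- rewrite -z2; apply: (@tiled_fill _ H _ G cl r d (rk ord0)) => //.
  + by move=> j; rewrite clE.
  + by rewrite -ltnS.
  + by rewrite z1.
Qed.

Local Open Scope ring_scope.

(** * Dense families of vertex sequences *)

Definition many (R : realType) n (c : R) (Q : 'I_n -> Prop) : Prop :=
  c * n%:R <= #|[set v | `[< Q v >]]|%:R.

(** A tree in which every inner node has at least [c * n] children, rather than a count of
    sequences: concatenation, greedy choice and Fubini then work entry by entry. *)
Fixpoint dense (R : realType) n (c : R) (k : nat) (P : seq 'I_n -> Prop) : Prop :=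
  if k is k'.+1 then many c (fun v => dense c k' (fun s => P (v :: s)))
  else P [::].

Lemma many_mono (R : realType) n (c c' : R) (Q Q' : 'I_n -> Prop) :
  c' <= c -> (forall v, Q v -> Q' v) -> many c Q -> many c' Q'.
Proof.
move=> cc QQ' h; apply: le_trans (le_trans h _).
  by rewrite ler_wpM2r.
rewrite ler_nat; apply: subset_leq_card; apply/subsetP => v; rewrite !inE.
by move=> /asboolP /QQ' ?; apply/asboolP.
Qed.

Lemma dense_mono (R : realType) n (c c' : R) k (P P' : seq 'I_n -> Prop) :
  c' <= c -> (forall s, size s = k -> P s -> P' s) ->
  dense c k P -> dense c' k P'.
Proof.
move=> cc; elim: k P P' => [|k IH] P P' PP' /=; first by apply: PP'.
apply: many_mono => // v; apply: IH => s ss; apply: PP'; by rewrite /= ss.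
Qed.

Lemma many_all (R : realType) n (c : R) (Q : 'I_n -> Prop) :
  c <= 1 -> (forall v, Q v) -> many c Q.
Proof.
move=> c1 QT; rewrite /many (_ : [set v | _] = setT).
  by rewrite cardsT card_ord -[leRHS]mul1r ler_wpM2r.
by apply/setP => v; rewrite !inE; apply/asboolP.
Qed.

Lemma dense_all (R : realType) n (c : R) k (P : seq 'I_n -> Prop) :
  c <= 1 -> (forall s, size s = k -> P s) -> dense c k P.
Proof.
move=> c1; elim: k P => [|k IH] P PT /=; first exact: PT.
by apply: many_all => // v; apply: IH => s ss; apply: PT; rewrite /= ss.
Qed.

Lemma many_ex (R : realType) n (c : R) (Q : 'I_n -> Prop) :
  0 < c -> (0 < n)%N -> many c Q -> exists v, Q v.
Proof.
move=> c0 n0 h.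
have : (0 < #|[set v | `[< Q v >]]|)%N.
  by rewrite -(ltr_nat R); apply: lt_le_trans h; rewrite mulr_gt0 // ltr0n.
by case/card_gt0P => v; rewrite inE => /asboolP; exists v.
Qed.

Lemma dense_ex (R : realType) n (c : R) k (P : seq 'I_n -> Prop) :
  0 < c -> (0 < n)%N -> dense c k P -> exists2 s, size s = k & P s.
Proof.
move=> c0 n0; elim: k P => [|k IH] P /=; first by exists [::].
case/(many_ex c0 n0) => v /IH [s ss Ps]; by exists (v :: s); rewrite //= ss.
Qed.

Lemma dense_cat (R : realType) n (c : R) k l (P : seq 'I_n -> Prop) :
  dense c (k + l) P <-> dense c k (fun s => dense c l (fun t => P (s ++ t))).
Proof.
elim: k P => [|k IH] P //=; split; apply: many_mono => // v.
  by move/IH.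
by move=> h; apply/IH.
Qed.

Lemma card_set_sum (R : realType) n (Q : 'I_n -> Prop) :
  #|[set v | `[< Q v >]]|%:R = \sum_(v < n) (`[< Q v >])%:R :> R.
Proof.
rewrite -sum1_card natr_sum big_mkcond /=; apply: eq_bigr => v _.
by rewrite inE; case: `[< _ >].
Qed.

(** Double counting: there are at least [(c * n) ^+ 2] pairs. The [v] with fewer than
    [c ^+ 2 / 2 * n] partners account for at most half of that, and each other [v] for at most
    [n]. *)
Lemma many_swap (R : realType) n (c : R) (Q : 'I_n -> 'I_n -> Prop) :
  0 <= c ->
  many c (fun u => many c (fun v => Q u v)) ->
  many (c ^+ 2 / 2) (fun v => many (c ^+ 2 / 2) (fun u => Q u v)).
Proof.
move=> c0 h; set d := c ^+ 2 / 2.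
have d0 : 0 <= d by rewrite /d divr_ge0 // exprn_ge0.
have [n0|n0] := posnP n.
  by subst n; rewrite /many mulr0.
have nR : 0 < n%:R :> R by rewrite ltr0n.
set S : R := \sum_(v < n) \sum_(u < n) (`[< Q u v >])%:R.
have lo : (c * n%:R) * (c * n%:R) <= S.
  rewrite /S exchange_big /=.
  apply: le_trans (_ : \sum_(u < n) (`[< many c (fun v => Q u v) >])%:R * (c * n%:R) <= _).
    by rewrite -mulr_suml -card_set_sum ler_wpM2r // mulr_ge0 // ltW.
  apply: ler_sum => u _; case: asboolP => [|_]; last by rewrite mul0r; apply: sumr_ge0.
  by rewrite mul1r /many card_set_sum.
have hi : S <= \sum_(v < n) ((`[< many d (fun u => Q u v) >])%:R * n%:R + d * n%:R).
  apply: ler_sum => v _; rewrite -card_set_sum; case: asboolP => [_|/negP].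
    rewrite mul1r; apply: le_trans (_ : n%:R <= _).
      by rewrite ler_nat -[X in (_ <= X)%N]card_ord max_card.
    by rewrite lerDl mulr_ge0 // ltW.
  by rewrite mul0r add0r -ltNge => /ltW.
rewrite big_split /= -mulr_suml -card_set_sum sumr_const card_ord in hi.
rewrite -[(d * n%:R) *+ n]mulr_natr in hi.
rewrite /many -(ler_pM2r nR); apply: le_trans (_ : c * n%:R * (c * n%:R) - d * n%:R * n%:R <= _).
  by rewrite /d le_eqVlt; apply/orP; left; apply/eqP; field.
by rewrite lerBlDr (le_trans lo hi).
Qed.

(** The single vertex passes the entries of the sequence one by one, by [many_swap]; the constant
    stays independent of [n]. *)
Lemma dense_swap (R : realType) (c : R) k :
  0 < c -> c <= 1 -> exists c' : R, [/\ 0 < c', c' <= c &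
    forall n (Q : 'I_n -> seq 'I_n -> Prop),
      (many c (fun v => dense c k (Q v)) ->
       dense c' k (fun s => many c' (fun v => Q v s))) /\
      (dense c k (fun s => many c (fun v => Q v s)) ->
       many c' (fun v => dense c' k (Q v)))].
Proof.
elim: k c => [|k IH] c c0 c1; first by exists c; split=> // n Q; split.
have d0 : 0 < c ^+ 2 / 2 by rewrite divr_gt0 // exprn_gt0.
have dc : c ^+ 2 / 2 <= c by nra.
have [c1' [c1'0 c1'd H1]] := IH _ d0 (le_trans dc c1).
have [c2 [c20 c2c H2]] := IH _ c0 c1.
have e0 : 0 < c2 ^+ 2 / 2 by rewrite divr_gt0 // exprn_gt0.
have ec : c2 ^+ 2 / 2 <= c2 by have c21 := le_trans c2c c1; nra.
exists (Num.min c1' (c2 ^+ 2 / 2)); split.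
- by rewrite lt_min c1'0.
- by rewrite ge_min (le_trans c1'd dc).
move=> n Q; split=> /=.
  move=> /(many_swap (ltW c0)); apply: many_mono.
    by rewrite ge_min c1'd.
  move=> v hv.
  have := (H1 n (fun u s => Q u (v :: s))).1
    (many_mono (lexx _) (fun u => dense_mono dc (fun _ _ => id)) hv).
  apply: dense_mono; rewrite ?ge_min ?lexx //.
  move=> s _; apply: many_mono => //; by rewrite ge_min lexx.
move=> h.
have : many c2 (fun u => many c2 (fun v => dense c2 k (fun s => Q v (u :: s)))).
  apply: many_mono h => // u; exact: (H2 n (fun v s => Q v (u :: s))).2.
move=> /(many_swap (ltW c20)); apply: many_mono; first by rewrite ge_min lexx orbT.
move=> v; apply: many_mono; first by rewrite ge_min lexx orbT.
move=> u; apply: dense_mono => //; by rewrite ge_min ec orbT.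
Qed.

(* [P (v :: s)] holds for many [v] given a typical [s], hence for many pairs
   [(v, v')] given [s]: a Fubini argument then moves [v'] to the front. *)
Lemma dense_double (R : realType) (c : R) k :
  0 < c -> c <= 1 -> exists c' : R, [/\ 0 < c', c' <= c &
    forall n (x0 : 'I_n) (i : nat) (P : seq 'I_n -> Prop), (i < k)%N ->
      dense c k P ->
      many c' (fun v => dense c' k (fun s => P s /\ P (set_nth x0 s i v)))].
Proof.
elim: k c => [|k IH] c c0 c1; first by exists c.
have [a [a0 ac Ha]] := dense_swap k c0 c1.
have [b [b0 ba Hb]] := dense_swap k a0 (le_trans ac c1).
have b1 : b <= 1 by apply: le_trans ba (le_trans ac c1).
have [b' [b'0 b'b Hb']] := dense_swap k b0 b1.
have [d [d0 dc Hd]] := IH _ c0 c1.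
have f0 : 0 < d ^+ 2 / 2 by rewrite divr_gt0 // exprn_gt0.
have fd : d ^+ 2 / 2 <= d by have d1 := le_trans dc c1; nra.
pose c' := Num.min b' (d ^+ 2 / 2).
have c'b' : c' <= b' by rewrite ge_min lexx.
have c'd : c' <= d ^+ 2 / 2 by rewrite ge_min lexx orbT.
exists c'; split.
- by rewrite lt_min b'0.
- by rewrite (le_trans c'd) // (le_trans fd).
move=> n x0 [|i] P ik /= h.
  (* At position 0, the set of good first entries of a typical [s] is used twice; [Hb] then brings
     [v] to the front and [Hb'] puts [u] back before [s]. *)
  have h1 : dense a k (fun s => many a (fun v => many a (fun u =>
     P (u :: s) /\ P (v :: s)))).
    apply: dense_mono ((Ha n _).1 h) => // s _ hs.
    apply: (many_mono (lexx a)) (hs) => v Pv.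
    by apply: (many_mono (lexx a)) (hs).
  have := (Hb n _).2 h1; apply: many_mono => [|v hv]; first exact: le_trans b'b.
  apply: (many_mono c'b' _ ((Hb' n (fun u s => P (u :: s) /\ P (v :: s))).2 _)).
    by move=> u; apply: (dense_mono c'b') => t _ [? ?]; split.
  by apply: dense_mono hv => // s _; apply: many_mono.
(* At a later position, the doubling is done below the first entry [u], and [v] is swapped with
   [u]. *)
have : many d (fun u => many d (fun v => dense d k (fun s =>
    P (u :: s) /\ P (u :: set_nth x0 s i v)))).
  apply: many_mono h => // u hu.
  exact: (Hd n x0 i (fun s => P (u :: s)) ik hu).
move=> /(many_swap (ltW d0)); apply: many_mono => // v.
apply: many_mono => // u; apply: dense_mono => //; exact: le_trans fd.
Qed.

(** Each entry of [lam] takes one doubling, which sends a new vertex to the front. Of the original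
    sequence only existence is kept. *)
Lemma dense_variants (R : realType) (c : R) k m :
  0 < c -> c <= 1 -> exists2 c' : R, 0 < c' &
    forall n (x0 : 'I_n) (lam : seq nat) (P : seq 'I_n -> Prop),
      size lam = m -> all (fun i => (i < k)%N) lam -> dense c k P ->
      dense c' m (fun s => exists2 t, size t = k & variants x0 lam s P t).
Proof.
move=> c0 c1.
suff [c' [c'0 c'c H]] : exists c' : R, [/\ 0 < c', c' <= c &
    forall n (x0 : 'I_n) (lam : seq nat) (P : seq 'I_n -> Prop),
      size lam = m -> all (fun i => (i < k)%N) lam -> dense c k P ->
      dense c' m (fun s => dense c' k (variants x0 lam s P))].
  exists c' => // n x0 lam P sl al h.
  have n0 : (0 < n)%N by case: n x0 {P h} => [[]|].
  apply: dense_mono (H _ x0 _ _ sl al h) => // s _ hs; exact: dense_ex c'0 n0 hs.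
elim: m c c0 c1 => [|m IH] c c0 c1.
  by exists c; split=> // n x0 [].
have [a [a0 ac Ha]] := dense_double k c0 c1.
have [b [b0 ba Hb]] := IH _ a0 (le_trans ac c1).
exists b; split=> //; first exact: le_trans ac.
move=> n x0 [|i lam] //= P [sl] /andP [ik al] h.
apply: many_mono (Ha _ x0 i P ik h) => // v hv.
exact: Hb hv.
Qed.

Lemma many_pigeonhole (R : realType) (I : finType) (i0 : I) n (c : R)
    (Q : I -> 'I_n -> Prop) :
  many c (fun v => exists i, Q i v) ->
  exists i, many (c / #|I|%:R) (Q i).
Proof.
move=> h; apply: contrapT => /forallNP hn.
have I0 : 0 < #|I|%:R :> R by rewrite ltr0n; apply/card_gt0P; exists i0.
have : #|[set v | `[< exists i, Q i v >]]|%:R <=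
   \sum_(i : I) #|[set v | `[< Q i v >]]|%:R :> R.
  rewrite -natr_sum ler_nat; apply: leq_trans (_ : #|\bigcup_(i : I) [set v | `[< Q i v >]]| <= _)%N.
    apply: subset_leq_card; apply/subsetP => v; rewrite inE => /asboolP [i Qi].
    by apply/bigcupP; exists i => //; rewrite inE; apply/asboolP.
  elim/big_ind2: _ => [|A k B l hA hB|//]; first by rewrite cards0.
  by apply: leq_trans (leq_card_setU _ _) (leq_add hA hB).
move/(le_trans h); apply/negP; rewrite -ltNge.
apply: lt_le_trans (_ : \sum_(i : I) (c / #|I|%:R * n%:R) <= _).
  apply: ltr_sum; first by apply/hasP; exists i0; rewrite ?mem_index_enum.
  by move=> i _; rewrite ltNge; apply/negP; apply: hn.
by rewrite sumr_const -[(_ * _) *+ _]mulr_natr mulrAC divfK ?gt_eqF // lexx.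
Qed.

(** An index is chosen for every subtree, then a frequent one among the children; each level loses a
    factor [#|I|] only in its own branching. *)
Lemma dense_pigeonhole (R : realType) (I : finType) (i0 : I) n (c : R) k
    (P : I -> seq 'I_n -> Prop) :
  dense c k (fun s => exists i, P i s) ->
  exists i, dense (c / #|I|%:R) k (P i).
Proof.
elim: k P => [|k IH] P //= h; apply: many_pigeonhole => //.
apply: many_mono h => // v; exact: IH.
Qed.

(** Every chosen entry joins [F], so [size F + k] is constant and each step loses at most
    [c / 2 * n] vertices. *)
Lemma dense_avoid (R : realType) n (c : R) k (P : seq 'I_n -> Prop)
    (F : seq 'I_n) :
  (size F + k)%:R <= c / 2 * n%:R -> dense c k P ->
  dense (c / 2) k (fun s => [/\ P s, uniq s & ~~ has (mem F) s]).
Proof.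
elim: k P F => [|k IH] P F //= Fk h.
rewrite /many; set A := [set v | _].
set B := [set v | `[< dense c k (fun s => P (v :: s)) >]] in h.
have BA : (#|B| <= #|A| + size F)%N.
  rewrite addnC -leq_subLR; apply: leq_trans (_ : #|B :\: [set v in F]| <= _)%N.
    rewrite cardsD leq_sub2l // (leq_trans (subset_leq_card (subsetIr _ _))) //.
    by rewrite cardsE; apply: card_size.
  apply: subset_leq_card; apply/subsetP => v; rewrite !inE.
  case/andP => vF /asboolP hv; apply/asboolP.
  have /IH : (size (v :: F) + k)%:R <= c / 2 * n%:R by rewrite /= addSnnS.
  move=> /(_ _ hv); apply: dense_mono => // s _ [Ps us sF].
  rewrite (negPf vF) us andbT; split=> //.
    apply/negP => vs; case/negP: sF; apply/hasP; exists v => //=.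
    by rewrite inE eqxx.
  apply: contra sF => /hasP [w ws wF]; apply/hasP; exists w => //=.
  by rewrite inE (wF : w \in F) orbT.
have : c * n%:R <= (#|A| + size F)%:R by rewrite (le_trans h) // ler_nat.
rewrite natrD in Fk *; have : (0 : R) <= k.+1%:R by [].
move: Fk; set x := #|A|%:R; set y := (size F)%:R; set z := k.+1%:R.
by set N := n%:R; move=> *; lra.
Qed.

(** By averaging over the next entry, some vertex keeps at least the fraction [c] of the surviving
    weight. *)
Lemma dense_average (R : realType) (I : finType) n (c : R) k
    (w : I -> R) (J : pred I) (P : I -> seq 'I_n -> Prop) :
  0 <= c -> (0 < n)%N -> (forall i, 0 <= w i) ->
  (forall i, J i -> dense c k (P i)) ->
  exists2 s, size s = k &
    c ^+ k * \sum_(i | J i) w i <= \sum_(i | J i && `[< P i s >]) w i.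
Proof.
move=> c0 n0 w0; elim: k J P => [|k IH] J P h.
  exists [::] => //; rewrite expr0 mul1r le_eqVlt; apply/orP; left; apply/eqP.
  apply: eq_bigl => i; case Ji: (J i) => //=; apply/esym/asboolP.
  exact: h Ji.
pose D v i := `[< dense c k (fun s => P i (v :: s)) >].
have [v hv] : exists v, c * \sum_(i | J i) w i <= \sum_(i | J i && D v i) w i.
  apply: contrapT => /forallNP hn.
  have : \sum_(v < n) \sum_(i | J i && D v i) w i <
         \sum_(v < n) (c * \sum_(i | J i) w i).
    apply: ltr_sum; last by move=> v _; rewrite ltNge; apply/negP.
    by apply/hasP; exists (Ordinal n0); rewrite ?mem_index_enum.
  apply/negP; rewrite -leNgt sumr_const card_ord -[_ *+ n]mulr_natr.
  under [leRHS]eq_bigr do rewrite big_mkcondr.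
  rewrite exchange_big /= mulrAC mulr_sumr; apply: ler_sum => i Ji.
  rewrite -big_mkcond /= sumr_const -[w i *+ _]mulr_natl ler_wpM2r //.
  apply: le_trans (h i Ji) _; rewrite ler_nat; apply: subset_leq_card.
  by apply/subsetP => v; rewrite inE.
have [|s ss hs] := IH (fun i => J i && D v i) (fun i s => P i (v :: s)).
  by move=> i /andP [_ /asboolP].
exists (v :: s); rewrite /= ?ss //.
rewrite exprSr -mulrA; apply: le_trans (ler_wpM2l (exprn_ge0 k c0) hv) _.
apply: le_trans hs _; rewrite [leLHS]big_mkcond [leRHS]big_mkcond /=.
by apply: ler_sum => i _; case: (J i) => //=; case: (D v i) => //=; case: ifP.
Qed.

(** * Many switching sets *)

Lemma min_degree_le n (G : ordered_graph n) v : (min_degree G <= degree G v)%N.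
Proof.
rewrite /min_degree; have : v \in index_enum 'I_n by rewrite mem_index_enum.
elim: (index_enum _) => //= u l IH; rewrite big_cons inE => /predU1P [->|/IH].
  exact: geq_minl.
exact/leq_trans/geq_minr.
Qed.

Lemma common_nbhd (R : realType) n (G : ordered_graph n) (F : seq 'I_n) :
  n%:R - (size F)%:R * (n%:R - (min_degree G)%:R) <=
  #|[set v | all (G v) F]|%:R :> R.
Proof.
elim: F => [|u F IH] /=.
  by rewrite mul0r subr0 (_ : [set v | _] = setT) ?cardsT ?card_ord //; apply/setP => v; rewrite !inE.
have deg : (min_degree G)%:R <= #|[set v | G v u]|%:R :> R.
  rewrite ler_nat (leq_trans (min_degree_le G u)) // subset_leq_card //.
  by apply/subsetP => v; rewrite !inE adj_sym.
have : (#|[set v | G v u]| + #|[set v | all (G v) F]| <=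
    #|[set v | G v u && all (G v) F]| + n)%N.
  rewrite -cardsUI addnC leq_add //; last by rewrite -[X in (_ <= X)%N]card_ord max_card.
  by apply: subset_leq_card; apply/subsetP => v; rewrite !inE.
rewrite -(ler_nat R) !natrD -[(size F).+1]add1n natrD mulrDl mul1r.
lra.
Qed.

(** Each vertex of [F] excludes at most [(1 / r - eta) * n] vertices, so at least [r * eta * n]
    remain. *)
Lemma many_common_nbhd (R : realType) n (G : ordered_graph n) r (eta : R)
    (F : seq 'I_n) : (0 < r)%N -> 0 <= eta ->
  (1 - 1 / r%:R + eta) * n%:R <= (min_degree G)%:R -> (size F <= r)%N ->
  many eta (fun v => all (G v) F).
Proof.
move=> r0 e0 deg Fr; rewrite /many (_ : [set v | _] = [set v | all (G v) F]); last first.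
  by apply/setP => v; rewrite !inE; apply/asboolP/idP.
apply: le_trans (common_nbhd R G F).
have d1 : (min_degree G)%:R <= n%:R :> R.
  case: n G deg F Fr => [|n] G _ _ _; first by rewrite /min_degree big_ord0.
  rewrite ler_nat (leq_trans (min_degree_le G ord0)) //.
  by rewrite -[X in (_ <= X)%N]card_ord max_card.
apply: le_trans (_ : n%:R - r%:R * (n%:R - (min_degree G)%:R) <= _); last first.
  by rewrite lerD2l lerN2 ler_wpM2r ?subr_ge0 // ler_nat.
have rR : 1 <= r%:R :> R by rewrite ler1n.
have h1 : n%:R - (min_degree G)%:R <= (1 / r%:R - eta) * n%:R by lra.
have h2 : r%:R * (n%:R - (min_degree G)%:R) <= r%:R * ((1 / r%:R - eta) * n%:R).
  by rewrite ler_wpM2l // ler0n.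
have h3 : r%:R * ((1 / r%:R - eta) * n%:R) = n%:R - r%:R * (eta * n%:R).
  by field; rewrite gt_eqF // (lt_le_trans ltr01).
have h4 : eta * n%:R <= r%:R * (eta * n%:R) by rewrite ler_peMl // mulr_ge0.
lra.
Qed.

(** Greedy choice, with the chosen vertices added to [F]: no step asks for common neighbours of more
    than [r] vertices. *)
Lemma dense_cliques (R : realType) n (G : ordered_graph n) r (eta : R)
    (F : seq 'I_n) k : (0 < r)%N -> 0 <= eta ->
  (1 - 1 / r%:R + eta) * n%:R <= (min_degree G)%:R -> (size F + k <= r.+1)%N ->
  dense eta k (fun s => pairwise G s && all (fun v => all (G v) F) s).
Proof.
move=> r0 e0 deg; elim: k F => [|k IH] F //= Fk.
have : many eta (fun v => all (G v) F).
  by apply: (many_common_nbhd r0 e0 deg); lia.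
apply: many_mono => // v vF.
have Fk' : (size (v :: F) + k <= r.+1)%N by rewrite /= addSnnS.
apply: dense_mono (IH _ Fk') => // s _.
case/andP => -> sF; rewrite vF andbT /=; apply/andP; split.
  by apply: sub_all sF => w /= /andP [wv _]; rewrite adj_sym.
by apply: sub_all sF => w /= /andP [].
Qed.

(** First [p] in [A], then [r - 1] common neighbours of [p] and [x], then a last vertex adjacent to
    these [r] clique vertices. Including [x] in that last step would exceed what the degree
    allows. *)
Lemma dense_clique_patterns (R : realType) n (G : ordered_graph n) r (eta : R)
    (A : 'I_n -> Prop) (x : 'I_n) : (0 < r)%N -> 0 < eta ->
  (1 - 1 / r%:R + eta) * n%:R <= (min_degree G)%:R ->
  (forall v, A v -> G x v) -> many (eta / 2) A ->
  dense (eta / 2) r.+1 (fun c => exists rq, clique_pattern (r := r) G A x rq c).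
Proof.
move=> r0 e0 deg xA; have e2 : eta / 2 <= eta by lra.
apply: many_mono => // p Ap.
have -> : r = (r.-1 + 1)%N by lia.
apply/dense_cat.
have h := dense_cliques (F := [:: p; x]) (k := r.-1) r0 (ltW e0) deg.
have px : (size [:: p; x] + r.-1 <= r.+1)%N by rewrite /=; lia.
apply: dense_mono (h px) => // s ss.
case/andP => ps sF.
have : many eta (fun v => all (G v) (p :: s)).
  by apply: (many_common_nbhd r0 (ltW e0) deg); rewrite /= ss prednK.
apply: many_mono => // w wF.
have Er : (r.-1 + 1 = r)%N by lia.
rewrite Er.
have pw : pairwise G (p :: s ++ [:: w]).
  rewrite /= pairwise_cat all_cat ps /= !andbT.
  move: wF => /= /andP [wp wF]; rewrite adj_sym wp andbT; apply/andP; split.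
    by apply: sub_all sF => v /= /andP [vp _]; rewrite adj_sym.
  by apply/allrelP => v u vs; rewrite inE => /eqP ->; rewrite adj_sym (allP wF).
apply: clique_pattern_ex => //.
  have lt (i j : 'I_r.+1) : (i < j)%N ->
      G (nth x (p :: s ++ [:: w]) i) (nth x (p :: s ++ [:: w]) j).
    move=> ij; apply: (pairwiseP x pw) => //;
      by rewrite inE /= size_cat ss Er.
  by move=> i j; rewrite neq_ltn => /orP [/lt //|/lt]; rewrite adj_sym.
move=> i ir; rewrite -cat_cons nth_cat /= ss prednK // ir.
have : all (G x) (p :: s).
  rewrite /= xA //; apply: sub_all sF => v /= /and3P [_ vx _].
  by rewrite adj_sym.
by move/all_nthP; apply; rewrite /= ss prednK.
Qed.

(** The pigeonhole fixes the ranking before the blow-up, so the labels [fl] may depend on it; [c]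
    depends on them only through their length. *)
Lemma dense_labelled_cliques (R : realType) r (eta : R) : (0 < r)%N ->
  0 < eta -> eta <= 1 -> forall m, exists2 c : R, 0 < c &
  forall fl : {perm 'I_r.+1} -> seq nat,
  (forall rk, size (fl rk) = m) ->
  forall n (G : ordered_graph n) (A : 'I_n -> Prop) (x : 'I_n),
  (1 - 1 / r%:R + eta) * n%:R <= (min_degree G)%:R ->
  (forall v, A v -> G x v) -> many (eta / 2) A ->
  exists rk q, dense c m (fun s => exists2 t, size t = r.+1 &
    variants x (unrank rk (fl rk)) s (clique_pattern G A x (rk, q)) t).
Proof.
move=> r0 e0 e1 m; pose I : finType := ({perm 'I_r.+1} * 'I_r.+1)%type.
have I0 : (0 < #|I|)%N by apply/card_gt0P; exists (1%g, ord0).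
set d := eta / 2 / #|I|%:R.
have d0 : 0 < d by rewrite /d !divr_gt0 // ltr0n.
have d1 : d <= 1.
  rewrite /d ler_pdivrMr ?ltr0n // mul1r (le_trans (_ : _ <= 1)) ?ler1n //; lra.
have [c c0 Hc] := dense_variants r.+1 m d0 d1.
exists c => // fl flm n G A x deg xA mA.
have := dense_clique_patterns r0 e0 deg xA mA.
case/(dense_pigeonhole ((1%g, ord0) : I)) => [[rk q] hd].
exists rk, q; apply: (Hc n x _ _ _ (unrank_lt _ _) hd).
by rewrite size_map flm.
Qed.

(** [A] will be a set of neighbours that are supposed to be bad for [x]; a single good [p] in it is
    then a contradiction. *)
Lemma dense_switch_nbhd (R : realType) h (H : ordered_graph h) cl r (eta : R) :
  (0 < r)%N -> interval_labels H cl -> (forall j, (j \in cl) = (j < r)%N) ->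
  0 < eta -> eta <= 1 ->
  exists c : R, [/\ 0 < c, c <= 1 & exists n1 : nat,
  forall n (G : ordered_graph n) (A : 'I_n -> Prop) (x : 'I_n), (n1 <= n)%N ->
  (1 - 1 / r%:R + eta) * n%:R <= (min_degree G)%:R ->
  (forall v, A v -> G x v) -> many (eta / 2) A ->
  exists2 p, A p & dense c (r.+1 * h).-1
    (fun s => tiled H G (x :: s) /\ tiled H G (p :: s))].
Proof.
move=> r0 Hc clE e0 e1; set M := (r.+1 * h).-1.
have [c c0 H1] := dense_labelled_cliques r0 e0 e1 M.+1.
have scl : size cl = h by case: Hc.
have cl0 : 0%N \in cl by rewrite clE.
pose d := Num.min (c / 2) 1.
have d0 : 0 < d by rewrite lt_min divr_gt0 // ltr01.
exists d; split=> //; first by rewrite ge_min lexx orbT.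
exists (Num.truncn ((2 + M)%:R / (c / 2))).+1 => n G A x nn deg xA mA.
have nc : (2 + M)%:R <= c / 2 * n%:R.
  rewrite mulrC -ler_pdivrMr ?divr_gt0 //; apply: ltW.
  apply: lt_le_trans (truncnS_gt _) _; by rewrite ler_nat.
have n0 : (0 < n)%N by apply: leq_trans nn.
(* The first label reserves the first entry for [p], in the layer of the clique vertex that lies in
   [A]. *)
pose fl (rk : {perm 'I_r.+1}) := (rk ord0 : nat) :: filling cl r (rk ord_max).
have [|rk [q]] := H1 fl _ n G A x deg xA mA.
  by move=> rk; rewrite /= size_filling // scl.
case/(many_ex c0 n0) => p hp.
have /(dense_avoid (F := [:: x; p])) : dense c M (fun s => exists2 t, size t = r.+1 &
    variants x (unrank rk (fl rk)) (p :: s) (clique_pattern G A x (rk, q)) t) := hp.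
move=> /(_ nc) hd.
have sw s : size s = M -> [/\ exists2 t, size t = r.+1 &
    variants x (unrank rk (fl rk)) (p :: s) (clique_pattern G A x (rk, q)) t,
    uniq s & ~~ has (mem [:: x; p]) s] ->
    [/\ A p, tiled H G (x :: s) & tiled H G (p :: s)].
  move=> ss [[t st vt] us sF].
  have xps y : y \in [:: x; p] -> y \notin s.
    by move=> yF; apply: contra sF => ys; apply/hasP; exists y.
  apply: clique_pattern_switch vt => //.
  - by rewrite size_filling // scl.
  - by rewrite /= us andbT xps // !inE eqxx orbT.
  - by rewrite xps // inE eqxx.
exists p.
  have c20 : 0 < c / 2 by rewrite divr_gt0.
  by have [s ss /(sw s ss) []] := dense_ex c20 n0 hd.
apply: dense_mono hd; first by rewrite ge_min lexx.
by move=> s ss /(sw s ss) [].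
Qed.

(** A blow-up with layer sizes given by [cl] carries one copy; [x] is an arbitrary vertex and [A]
    its whole neighbourhood. *)
Lemma dense_copies (R : realType) h (H : ordered_graph h) cl r (eta : R) :
  (0 < r)%N -> interval_labels H cl -> (forall j, (j \in cl) = (j < r)%N) ->
  0 < eta -> eta <= 1 ->
  exists c : R, [/\ 0 < c, c <= 1 & exists n1 : nat,
  forall n (G : ordered_graph n), (n1 <= n)%N ->
  (1 - 1 / r%:R + eta) * n%:R <= (min_degree G)%:R ->
  dense c h (tiled H G)].
Proof.
move=> r0 Hc clE e0 e1.
have [c c0 H1] := dense_labelled_cliques r0 e0 e1 h.
have scl : size cl = h by case: Hc.
pose d := Num.min (c / 2) 1.
have d0 : 0 < d by rewrite lt_min divr_gt0 // ltr01.
exists d; split=> //; first by rewrite ge_min lexx orbT.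
exists (Num.truncn (h%:R / (c / 2))).+1 => n G nn deg.
have nc : (size ([::] : seq 'I_n) + h)%:R <= c / 2 * n%:R.
  rewrite mulrC -ler_pdivrMr ?divr_gt0 //; apply: ltW.
  apply: lt_le_trans (truncnS_gt _) _; by rewrite ler_nat.
have n0 : (0 < n)%N by apply: leq_trans nn.
pose x := Ordinal n0.
have mx : many (eta / 2) (fun v => G x v).
  apply: many_mono (many_common_nbhd (F := [:: x]) r0 (ltW e0) deg r0).
    by lra.
  by move=> v /= /andP [vx _]; rewrite adj_sym.
have [|rk [q hd]] := H1 (fun=> cl) _ n G _ x deg (fun v => id) mx; first by [].
have := dense_avoid nc hd.
apply: dense_mono; first by rewrite ge_min lexx.
move=> s ss [[t st vt] us _].
have [||lz _] := clique_pattern_layered _ _ vt; rewrite ?ss //.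
  by apply/allP => a; rewrite clE => /ltnW.
have z2 : unzip2 (zip cl s) = s by rewrite unzip2_zip // ss scl.
rewrite -z2; apply: (tiled_copy lz _ Hc); first by rewrite z2.
by rewrite unzip1_zip // ss scl.
Qed.

Lemma dense_switch (R : realType) h (H : ordered_graph h) cl r (eta : R) :
  (1 < r)%N -> interval_labels H cl -> (forall j, (j \in cl) = (j < r)%N) ->
  0 < eta -> eta <= 1 ->
  exists c : R, exists M : nat, [/\ 0 < c, c <= 1 & exists n1 : nat,
  forall n (G : ordered_graph n) (x y : 'I_n), (n1 <= n)%N ->
  (1 - 1 / r%:R + eta) * n%:R <= (min_degree G)%:R ->
  dense c M (fun s => tiled H G (x :: s) /\ tiled H G (y :: s))].
Proof.
move=> r1 Hc clE e0 e1; have r0 := ltnW r1.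
have [c [c0 c1 [n1 H1]]] := dense_switch_nbhd r0 Hc clE e0 e1.
set M := (r.+1 * h).-1 in H1; pose d := Num.min c eta.
have d0 : 0 < d by rewrite lt_min c0.
have dc : d <= c by rewrite ge_min lexx.
have de : d <= eta by rewrite ge_min lexx orbT.
exists (d / 2), (1 + (M + M))%N; split; [by rewrite divr_gt0|lra|].
exists (maxn n1 (Num.truncn ((2 + (1 + (M + M)))%:R / (d / 2))).+1).
move=> n G x y; rewrite geq_max => /andP [nn1 nn] deg.
have nc : (size [:: x; y] + (1 + (M + M)))%:R <= d / 2 * n%:R.
  rewrite mulrC -ler_pdivrMr ?divr_gt0 //; apply: ltW.
  apply: lt_le_trans (truncnS_gt _) _; by rewrite ler_nat.
pose good u p := dense c M (fun s => tiled H G (u :: s) /\ tiled H G (p :: s)).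
have few u : ~ many (eta / 2) (fun p => G u p /\ ~ good u p).
  by move=> /(H1 n G _ u nn1 deg (fun v => @proj1 _ _)) [p []].
(* As [1 / r <= 1 / 2], there are at least [2 * eta * n] common neighbours, and the two bad sets
   remove fewer than [eta * n] of them. *)
have key : many d (fun p => good x p /\ good y p).
  pose B u := [set p | `[< G u p /\ ~ good u p >]].
  have BE u : #|B u|%:R < eta / 2 * n%:R.
    by rewrite ltNge; apply/negP; apply: few.
  pose C := [set v | all (G v) [:: x; y]].
  rewrite /many; set D := [set v | _].
  have : (#|C| <= #|D| + #|B x| + #|B y|)%N.
    apply: leq_trans (_ : #|D :|: B x :|: B y| <= _)%N.
      apply: subset_leq_card; apply/subsetP => v; rewrite !inE /= andbT.
      rewrite adj_sym [G v y]adj_sym => /andP [xv yv].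
      have [gx|gx] := pselect (good x v); last first.
        by apply/orP; left; apply/orP; right; apply/asboolP.
      have [gy|gy] := pselect (good y v); last first.
        by apply/orP; right; apply/asboolP.
      by apply/orP; left; apply/orP; left; apply/asboolP.
    by rewrite (leq_trans (leq_card_setU _ _)) // leq_add2r leq_card_setU.
  rewrite -(ler_nat R) !natrD; have := common_nbhd R G [:: x; y].
  rewrite -/C /=; have := BE x; have := BE y.
  have r2 : 1 / r%:R <= 1 / 2 :> R.
    by rewrite ler_pdivrMr ?ltr0n // mulrC mulrA ler_pdivlMr // mul1r mulr1 ler_nat.
  have : 1 / r%:R * n%:R <= 1 / 2 * n%:R :> R by rewrite ler_wpM2r.
  have : d * n%:R <= eta * n%:R by rewrite ler_wpM2r.
  move: deg; rewrite !mulrDl mulNr; lra.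
(* With [x] added, the tiled parts are [x :: X] and [p :: Y]; with [y] added, they are [p :: X] and
   [y :: Y]. *)
have : dense d (1 + (M + M)) (fun s => exists p X Y, [/\ s = p :: X ++ Y,
    size X = M, tiled H G (x :: X) /\ tiled H G (p :: X) &
    tiled H G (y :: Y) /\ tiled H G (p :: Y)]).
  apply: many_mono key => // p [gx gy]; apply/dense_cat.
  apply: dense_mono gx => // X sX tX; apply: dense_mono gy => // Y _ tY.
  by exists p, X, Y.
move=> /(dense_avoid nc); apply: dense_mono => // s _.
case=> [[p [X [Y [-> _ [xX pX] [yY pY]]]]] us xys].
have notin u : u \in [:: x; y] -> u \notin p :: X ++ Y.
  by move=> uF; apply: contra xys => us'; apply/hasP; exists u.
have uxs u : u \in [:: x; y] -> uniq (u :: p :: X ++ Y).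
  by move=> uF; rewrite cons_uniq us notin.
have pXY : perm_eq (p :: X ++ Y) (X ++ p :: Y).
  by apply/permPl; apply: (perm_catCA [:: p] X Y).
split.
  have ux := uxs x (mem_head _ _).
  have px : perm_eq (x :: p :: X ++ Y) ((x :: X) ++ (p :: Y)) by rewrite perm_cons.
  apply: (@tiled_eq_mem _ _ _ _ ((x :: X) ++ (p :: Y))).
    by move=> v; rewrite (perm_mem px).
  by move: ux; rewrite (perm_uniq px) cat_uniq => /and3P [_ ? _]; apply: tiled_cat.
have uy : uniq (y :: p :: X ++ Y) by apply: uxs; rewrite !inE eqxx orbT.
have py : perm_eq (y :: p :: X ++ Y) ((p :: X) ++ (y :: Y)).
  by apply/permPl; apply: (perm_catCA [:: y] (p :: X) Y).
apply: (@tiled_eq_mem _ _ _ _ ((p :: X) ++ (y :: Y))).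
  by move=> v; rewrite (perm_mem py).
by move: uy; rewrite (perm_uniq py) cat_uniq => /and3P [_ ? _]; apply: tiled_cat.
Qed.

(** * Absorbers *)

Fixpoint switchers h (H : ordered_graph h) n (G : ordered_graph n) M
    (qs ys s : seq 'I_n) : Prop :=
  match qs, ys with
  | q :: qs', y :: ys' =>
      [/\ tiled H G (q :: take M s), tiled H G (y :: take M s)
        & switchers H G M qs' ys' (drop M s)]
  | _, _ => True
  end.

Lemma dense_switchers (R : realType) h (H : ordered_graph h) n
    (G : ordered_graph n) M (c : R) (qs ys : seq 'I_n) :
  c <= 1 ->
  (forall x y, dense c M (fun s => tiled H G (x :: s) /\ tiled H G (y :: s))) ->
  dense c (size qs * M) (switchers H G M qs ys).
Proof.
move=> c1 sw; elim: qs ys => [|q qs IH] [|y ys] //=; first exact: dense_all.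
rewrite mulSn; apply/dense_cat; apply: dense_mono (sw q y) => // s ss [sq sy].
apply: dense_mono (IH ys) => // t _ ht.
by rewrite take_size_cat // drop_size_cat.
Qed.

Lemma tiled_switchers h (H : ordered_graph h) n (G : ordered_graph n) M
    (qs ys s : seq 'I_n) : size ys = size qs -> size s = (size qs * M)%N ->
  switchers H G M qs ys s ->
  (uniq (qs ++ s) -> tiled H G (qs ++ s)) /\
  (uniq (ys ++ s) -> tiled H G (ys ++ s)).
Proof.
elim: qs ys s => [|q qs IH] [|y ys] s //=.
  by move=> _ /size0nil -> _; split=> _; apply: tiled_nil.
move=> [sy]; rewrite mulSn => ss [tq ty sw].
have sd : size (drop M s) = (size qs * M)%N by rewrite size_drop ss addKn.
have [IHq IHy] := IH ys _ sy sd sw.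
have step v vs : tiled H G (v :: take M s) ->
    (uniq (vs ++ drop M s) -> tiled H G (vs ++ drop M s)) ->
    uniq (v :: vs ++ s) -> tiled H G (v :: vs ++ s).
  move=> tv tvs uv.
  have pv : perm_eq (v :: vs ++ s) ((v :: take M s) ++ (vs ++ drop M s)).
    by rewrite -{1}(cat_take_drop M s) /= perm_cons; apply/permPl; apply: perm_catCA.
  move: uv; rewrite (perm_uniq pv) cat_uniq => /and3P [_ d uv].
  apply: (@tiled_eq_mem _ _ _ _ ((v :: take M s) ++ (vs ++ drop M s))).
    by move=> u; rewrite (perm_mem pv).
  by apply: tiled_cat => //; apply: tvs.
by split; apply: step.
Qed.

(** [A] is a copy [Y] followed by switching sets [X] pairing [q] with [Y]. Alone, [X] is completed
    by [Y]; in the presence of [q], it is completed by [q] and [Y] is tiled by itself. *)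
Lemma dense_absorbers (R : realType) h (H : ordered_graph h) n
    (G : ordered_graph n) M (c : R) (q F : seq 'I_n) :
  let m := (h + h * M)%N in c <= 1 ->
  dense c h (tiled H G) ->
  (forall x y, dense c M (fun s => tiled H G (x :: s) /\ tiled H G (y :: s))) ->
  size q = h -> uniq q -> (h + size F + m)%:R <= c / 2 * n%:R ->
  dense (c / 2) m (fun A => [/\ tiled H G A, tiled H G (A ++ q), uniq A
                              & ~~ has (mem F) A]).
Proof.
move=> m c1 hc sw sq uq nn.
have : dense c m (fun A => tiled H G (take h A) /\
    switchers H G M q (take h A) (drop h A)).
  apply/dense_cat; apply: dense_mono hc => // Y sY tY; rewrite -[X in (X * M)%N]sq.
  apply: dense_mono (dense_switchers q Y c1 sw) => // X _ hX.
  by rewrite take_size_cat // drop_size_cat.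
have nn' : (size (q ++ F) + m)%:R <= c / 2 * n%:R by rewrite size_cat sq.
move=> /(dense_avoid nn'); apply: dense_mono => // A sA.
case; set Y := take h A; set X := drop h A => -[tY hsw] uA qFA.
have AE : A = Y ++ X by rewrite cat_take_drop.
have sY : size Y = size q by rewrite sq size_take_min sA (minn_idPl (leq_addr _ _)).
have sX : size X = (size q * M)%N by rewrite size_drop sA addKn sq.
have [tq ty] := tiled_switchers sY sX hsw.
have qA v : v \in q -> v \notin A.
  move=> vq; apply: contra qFA => vA; apply/hasP; exists v => //=.
  by rewrite mem_cat vq.
have uAq : uniq (A ++ q).
  by rewrite cat_uniq uA uq andbT; apply/hasPn => v /qA.
have pq : perm_eq (A ++ q) (Y ++ (q ++ X)).
  by rewrite {1}AE -catA perm_cat2l perm_catC.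
move: uAq; rewrite (perm_uniq pq) cat_uniq => /and3P [_ dYq uqX].
split=> //; first by rewrite AE; apply: ty; rewrite -AE.
  apply: (@tiled_eq_mem _ _ _ _ (Y ++ (q ++ X))).
    by move=> v; rewrite (perm_mem pq).
  by apply: tiled_cat => //; apply: tq.
apply: contra qFA => /hasP [v vA vF]; apply/hasP; exists v => //=.
by rewrite mem_cat (vF : v \in F) orbT.
Qed.

Definition absorbs h (H : ordered_graph h) n (G : ordered_graph n)
    (q A : seq 'I_n) : bool := `[< tiled H G (A ++ q) >].

(** Each block of [h] vertices of [w] uses up one absorber, which lowers the count of any other [q]
    by at most one. *)
Lemma tiled_family h (H : ordered_graph h) n (G : ordered_graph n)
    (Fm : seq (seq 'I_n)) (w : seq 'I_n) j :
  uniq (flatten Fm ++ w) -> size w = (h * j)%N ->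
  (forall A, A \in Fm -> tiled H G A) ->
  (forall q, size q = h -> uniq q -> (j <= count (absorbs H G q) Fm)%N) ->
  tiled H G (flatten Fm ++ w).
Proof.
elim: j Fm w => [|j IH] Fm w uFw sw tF qF.
  rewrite muln0 in sw; rewrite (size0nil sw) cats0 in uFw *.
  elim: Fm uFw tF {qF} => [|A Fm IHF] /=; first by move=> *; apply: tiled_nil.
  rewrite cat_uniq => /and3P [_ d u] tF; apply: tiled_cat => //.
    by apply: tF; rewrite inE eqxx.
  by apply: IHF => // B BF; apply: tF; rewrite inE BF orbT.
have hw : (h <= size w)%N by rewrite sw mulnS leq_addr.
set q := take h w; set w' := drop h w.
have sq : size q = h by rewrite size_take_min (minn_idPl hw).
have uq : uniq q by apply: take_uniq; move: uFw; rewrite cat_uniq => /and3P [].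
have : has (absorbs H G q) Fm by rewrite has_count; apply: leq_trans (qF q sq uq).
case/hasP => A AF Aq; have pF := perm_to_rem AF.
have pFw : perm_eq (flatten Fm ++ w) ((A ++ q) ++ (flatten (rem A Fm) ++ w')).
  rewrite (permPl (perm_cat (perm_flatten pF) (perm_refl w))) /= -!catA perm_cat2l.
  by rewrite -{1}(cat_take_drop h w) perm_catCA.
apply: (@tiled_eq_mem _ _ _ _ ((A ++ q) ++ (flatten (rem A Fm) ++ w'))).
  by move=> v; rewrite (perm_mem pFw).
move: uFw; rewrite (perm_uniq pFw) cat_uniq => /and3P [_ d u].
apply: tiled_cat => //; first exact/asboolP.
apply: IH => // [|B /mem_rem /tF //|q' sq' uq'].
  by rewrite size_drop sw mulnS addKn.
have := qF q' sq' uq'; rewrite (seq.permP pF) /=.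
by case: (absorbs H G q' A) => /=; rewrite ?add0n; [|apply: ltnW].
Qed.

Lemma size_flatten_const (T : eqType) (Fm : seq (seq T)) m :
  (forall A, A \in Fm -> size A = m) -> size (flatten Fm) = (size Fm * m)%N.
Proof.
move=> AFm; rewrite size_flatten mulnC -sumn_nseq -(size_map size); congr sumn.
by apply/all_pred1P/allP => _ /mapP [A /AFm <- ->] /=.
Qed.

(* The family is chosen greedily: the next absorber makes the total weight
   drop by the factor [1 - c ^+ m / 2], where [q] has weight [1/2] to the
   number of absorbers of [q] so far. *)
Lemma absorbing_family (R : realType) h (H : ordered_graph h) n
    (G : ordered_graph n) m (c : R) k :
  (0 < n)%N -> 0 <= c -> c <= 1 ->
  (forall F q : seq 'I_n, (size F <= k * m)%N -> size q = h -> uniq q ->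
     dense c m (fun A => [/\ tiled H G A, tiled H G (A ++ q), uniq A
                            & ~~ has (mem F) A])) ->
  exists Fm : seq (seq 'I_n), [/\ (size Fm <= k)%N,
    forall A, A \in Fm -> size A = m /\ tiled H G A, uniq (flatten Fm)
    & \sum_(q : h.-tuple 'I_n | uniq q) (1 / 2) ^+ count (absorbs H G q) Fm
        <= n%:R ^+ h * (1 - c ^+ m / 2) ^+ k].
Proof.
move=> n0 c0 c1; elim: k => [|k IH] Hd.
  (* All weights are 1 and there are at most [n ^ h] tuples. *)
  exists [::]; split=> //; rewrite expr0 mulr1 -natrX.
  under eq_bigr do rewrite expr0.
  rewrite -[n in leRHS](card_ord n) -card_tuple sumr_const ler_nat.
  exact: max_card.
have [|Fm [sFm AFm uFm wFm]] := IH.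
  by move=> F q sF; apply: Hd; rewrite mulSn (leq_trans sF) // leq_addl.
have sF : (size (flatten Fm) <= k.+1 * m)%N.
  rewrite (@size_flatten_const _ _ m) => [|A /AFm []//].
  by rewrite leq_mul2r (leq_trans sFm) ?orbT.
pose w (q : h.-tuple 'I_n) : R := (1 / 2) ^+ count (absorbs H G q) Fm.
have w0 q : 0 <= w q by rewrite exprn_ge0 // divr_ge0.
have Hd' (q : h.-tuple 'I_n) := Hd (flatten Fm) q sF (size_tuple q).
have [A sA hA] := dense_average c0 n0 w0 Hd'.
set S := \sum_(q | _) _ in hA; have S0 : 0 <= S by apply: sumr_ge0.
set T := \sum_(q | _) _ in hA.
have rho0 : 0 <= 1 - c ^+ m / 2.
  have : c ^+ m <= 1 by rewrite exprn_ile1.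
  lra.
(* Adding [A] halves the weights counted in [T], and [T] is at least [c ^+ m * S] by averaging. *)
have fin (X : R) : X <= S - T / 2 -> X <= n%:R ^+ h * (1 - c ^+ m / 2) ^+ k.+1.
  move=> XS; rewrite exprSr mulrA.
  apply: le_trans (_ : S * (1 - c ^+ m / 2) <= _); last by rewrite ler_wpM2r.
  by apply: le_trans XS _; rewrite mulrBr mulr1; lra.
(* If [A] violates a condition that does not involve [q], then [T = 0] and the old family already
   meets the bound. *)
have [[tA uA FA]|nA] := pselect [/\ tiled H G A, uniq A & ~~ has (mem (flatten Fm)) A].
  exists (A :: Fm); split=> //=.
  - by move=> B; rewrite inE => /predU1P [->|/AFm].
  - by rewrite cat_uniq uA uFm andbT has_sym.
  apply: fin; rewrite /S /T big_mkcondr /= mulr_suml -sumrB; apply: ler_sum => q uq.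
  rewrite exprD -/(w q); have := w0 q; move: (w q) => X X0.
  case: asboolP => [[_ tq _ _]|_].
    have -> : absorbs H G q A by apply/asboolP.
    by rewrite expr1; lra.
  rewrite mul0r subr0 ler_piMl //.
  by case: (absorbs _ _ _ _); rewrite ?expr0 // expr1; lra.
exists Fm; split=> //; first exact: leqW.
apply: fin; have -> : T = 0.
  by rewrite /T big1 // => q /andP [_ /asboolP [? _ ? ?]]; case: nA.
by rewrite mul0r subr0.
Qed.

(** * Colour lists from interval colourings *)

Lemma bigminn_le (I : finType) (P : pred I) (F : I -> nat) d i :
  P i -> (\big[minn/d]_(j | P j) F j <= F i)%N.
Proof.
move=> Pi; have : i \in index_enum I by rewrite mem_index_enum.
elim: (index_enum _) => //= u l IH; rewrite big_cons inE => /predU1P [<-|/IH h].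
  by rewrite Pi geq_minl.
by case: ifP => // _; exact/leq_trans/h/geq_minr.
Qed.

Lemma bigminn_attained (I : finType) (P : pred I) (F : I -> nat) d :
  \big[minn/d]_(j | P j) F j = d \/
  exists2 i, P i & \big[minn/d]_(j | P j) F j = F i.
Proof.
elim/big_rec: _ => [|i x Pi [->|[j Pj ->]]]; first by left.
  by rewrite /minn; case: ifP; [right; exists i|left].
by right; rewrite /minn; case: ifP; [exists i|exists j].
Qed.

Lemma interval_labels_fun h (H : ordered_graph h) (f : 'I_h -> nat) :
  {homo f : i j / (i <= j)%N} -> (forall i j, H i j -> f i != f j) ->
  interval_labels H [seq f i | i <- enum 'I_h].
Proof.
move=> fm fp; have fE (i : 'I_h) : nth 0%N [seq f i | i <- enum 'I_h] i = f i.
  by rewrite (nth_map i) ?size_enum_ord // nth_ord_enum.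
split; first by rewrite size_map size_enum_ord.
  apply/(sortedP 0%N) => i; rewrite size_map size_enum_ord => ih.
  by rewrite (fE (Ordinal ih)) (fE (Ordinal (ltnW ih))); apply: fm.
by move=> i j /fp; rewrite !fE.
Qed.

(** Renumbering the colours that occur as 0, 1, ... is monotone because [undup] of a sorted list is
    sorted. *)
Lemma interval_labels_compress h (H : ordered_graph h) lam :
  interval_labels H lam ->
  interval_labels H [seq index i (undup lam) | i <- lam].
Proof.
case=> sl ol pl; have ou : sorted leq (undup lam).
  by apply: (subseq_sorted leq_trans (undup_subseq lam)).
split; first by rewrite size_map.
  rewrite sorted_map; apply: (sub_in_sorted (P := mem lam)) (ol) => [i j il jl ij|].
    rewrite /= leqNgt; apply/negP => ji.
    have ji' : (j <= i)%N.
      by apply: (sorted_ltn_index leq_trans ou) ji; rewrite mem_undup.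
    have ijE : i = j by apply/eqP; rewrite eqn_leq ij ji'.
    by move: ji; rewrite ijE ltnn.
  exact/allP.
move=> i j /pl; rewrite !(nth_map 0%N) ?sl //; apply: contra => /eqP.
have iu (k : 'I_h) : nth 0%N lam k \in undup lam by rewrite mem_undup mem_nth ?sl.
by move/(congr1 (nth 0%N (undup lam))); rewrite !nth_index // => ->.
Qed.

(** Every vertex is coloured by the least element of its interval. *)
Lemma interval_labels_chromatic h (H : ordered_graph h) :
  exists2 lam, interval_labels H lam &
    (size (undup lam) <= interval_chromatic_number H)%N.
Proof.
rewrite /interval_chromatic_number.
have := @bigminn_attained {set {set 'I_h}} (interval_coloring H) (fun P => #|P|) h.
case=> [->|].
  (* The default value [h] is realised by giving all vertices different colours. *)
  exists [seq nat_of_ord i | i <- enum 'I_h].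
    apply: interval_labels_fun => // i j; apply: contraTneq => /val_inj ->.
    by rewrite adj_irr.
  by rewrite (leq_trans (size_undup _)) // size_map size_enum_ord.
case=> P /andP [partP /forallP colP] ->.
have covP (i : 'I_h) : i \in cover P by rewrite (cover_partition partP) inE.
have trP := partition_trivIset partP.
have PB (i : 'I_h) : pblock P i \in P by apply: pblock_mem.
have iB (i : 'I_h) : i \in pblock P i by rewrite mem_pblock.
pose f (B : {set 'I_h}) := (\big[minn/h]_(k in B) k)%N.
have f_le (i : 'I_h) : (f (pblock P i) <= i)%N by apply: bigminn_le.
have f_mem (i : 'I_h) : exists2 k : 'I_h, k \in pblock P i & f (pblock P i) = k.
  have [E|//] := bigminn_attained (mem (pblock P i)) (@nat_of_ord h) h.
  by have := f_le i; rewrite /f E leqNgt ltn_ord.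
exists [seq f (pblock P i) | i <- enum 'I_h].
  apply: interval_labels_fun => i j.
    (* Otherwise the least element of the interval of [j] lies below [i], and convexity puts [i]
       into that interval. *)
    move=> ij; rewrite leqNgt; apply/negP => lt.
    have [k kB kE] := f_mem j.
    have := colP (pblock P j); rewrite PB /= => /andP [/forall_inP intv _].
    have := intv k kB => /forall_inP /(_ j (iB j)) /forallP /(_ i) /implyP.
    rewrite ij -kE (leq_trans (ltnW lt) (f_le i)) => /(_ isT) /(def_pblock trP (PB j)) E.
    by rewrite E ltnn in lt.
  move=> Hij; apply/eqP => E; have [k kB kE] := f_mem i; have [l lB lE] := f_mem j.
  have kl : k = l by apply: val_inj; rewrite /= -kE -lE.
  have ji : pblock P j = pblock P i.
    by rewrite -(def_pblock trP (PB j) lB) -(def_pblock trP (PB i) kB) kl.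
  have := colP (pblock P i); rewrite PB /= => /andP [_ /forall_inP ind].
  have := ind i (iB i) => /forall_inP /(_ j); rewrite -ji iB Hij.
  by move/(_ isT).
rewrite cardE -(size_map f); apply: uniq_leq_size; first exact: undup_uniq.
move=> k; rewrite mem_undup => /mapP [i _ ->]; apply: map_f.
by rewrite mem_enum.
Qed.

Lemma surjective_interval_labels h (H : ordered_graph h) : (0 < h)%N ->
  exists cl r, [/\ interval_labels H cl, forall j, (j \in cl) = (j < r)%N,
    (0 < r)%N & (r <= interval_chromatic_number H)%N].
Proof.
move=> h0; have [lam Hlam szl] := interval_labels_chromatic H.
exists [seq index i (undup lam) | i <- lam], (size (undup lam)).
split=> //; first exact: interval_labels_compress.
  move=> j; apply/mapP/idP => [[i il ->]|ju].
    by rewrite index_mem mem_undup.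
  exists (nth 0%N (undup lam) j); last by rewrite index_uniq ?undup_uniq.
  by rewrite -mem_undup mem_nth.
case: Hlam => sl _ _; rewrite lt0n size_eq0; apply: contraTneq h0 => E.
by rewrite -sl; case: lam E {szl sl} => // a l E; have := mem_undup (a :: l) a;
  rewrite E inE eqxx.
Qed.

Lemma tiled_monochromatic h (H : ordered_graph h) n (G : ordered_graph n) cl w k :
  interval_labels H cl -> (forall j, (j \in cl) = (j < 1)%N) ->
  uniq w -> size w = (h * k)%N -> tiled H G w.
Proof.
move=> Hc clE uw sw; have [sc _ _] := Hc.
have cl0 : cl = nseq h 0%N.
  by rewrite -sc; apply/all_pred1P/allP => j; rewrite clE ltnS leqn0.
pose z := zip (nseq (size w) 0%N) w.
have z1 : unzip1 z = nseq (size w) 0%N by rewrite unzip1_zip // size_nseq.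
have z2 : unzip2 z = w by rewrite unzip2_zip // size_nseq.
have z0 a : a \in z -> a.1 = 0%N.
  by move=> /(map_f fst); rewrite (z1 : map fst z = _) mem_nseq => /andP [_ /eqP].
rewrite -z2; apply: (@tiled_layered _ _ _ _ _ (nseq k cl)).
- by move=> a b /z0 -> /z0 ->.
- by rewrite z2.
- by move=> lam; rewrite mem_nseq => /andP [_ /eqP ->].
rewrite z1 sw cl0; elim: k {sw} => [|k IH] /=; first by rewrite muln0.
by rewrite mulnS nseqD perm_cat2l.
Qed.

(** * Estimates and the choice of constants *)

Lemma poly_lt_exp2 (R : realType) (sigma : R) (h : nat) : 0 < sigma ->
  exists n0 : nat, forall n s, (n0 <= n)%N -> sigma * n%:R < s.+1%:R ->
    (n ^ h < 2 ^ s)%N.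
Proof.
move=> s0; pose b : R := sigma / h.+1%:R.
have b0 : 0 < b by rewrite divr_gt0 ?ltr0n.
exists (Num.truncn (b ^- h.+1)).+1 => n s nn sn.
have n0 : (0 < n)%N by apply: leq_trans nn.
have nb : 1 <= n%:R * b ^+ h.+1.
  rewrite -ler_pdivrMr ?exprn_gt0 // div1r; apply: ltW.
  by apply: lt_le_trans (truncnS_gt _) _; rewrite ler_nat.
pose q := (s %/ h.+1)%N.
(* The chain is [n ^ h <= (b * n) ^ h.+1 < q.+1 ^ h.+1 <= (2 ^ q) ^ h.+1 <= 2 ^ s]. *)
apply: (@leq_trans (q.+1 ^ h.+1)%N); last first.
  apply: leq_trans (_ : (2 ^ q) ^ h.+1 <= _)%N; first by rewrite leq_exp2r // ltn_expl.
  by rewrite -expnM leq_exp2l // leq_trunc_div.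
rewrite -(ltr_nat R) !natrX.
have bq : b * n%:R < q.+1%:R.
  rewrite /b mulrAC ltr_pdivrMr ?ltr0n //; apply: lt_le_trans sn _.
  by rewrite -natrM ler_nat /q ltn_ceil.
apply: le_lt_trans (_ : (b * n%:R) ^+ h.+1 < _); last first.
  by rewrite ltrXn2r // mulr_ge0 // ltW.
rewrite exprMn [n%:R ^+ h.+1]exprS mulrA mulrC ler_peMr ?exprn_ge0 //.
by rewrite mulrC.
Qed.

(** By Bernoulli [(1 + a) ^+ L] is at least 4, and [(1 - a) * (1 + a) <= 1]. *)
Lemma geometric_small (R : realType) (a : R) : 0 < a -> a <= 1 ->
  exists2 L, (0 < L)%N & (1 - a) ^+ L * 4 <= 1.
Proof.
move=> a0 a1; exists (Num.truncn (3 / a)).+1 => //.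
set L := _.+1; have La : 3 <= L%:R * a.
  by rewrite -ler_pdivrMr // ltW // truncnS_gt.
have bern : forall l, 1 + l%:R * a <= (1 + a) ^+ l.
  elim=> [|l IH]; first by rewrite mul0r addr0 expr0.
  rewrite exprS; apply: le_trans (_ : (1 + a) * (1 + l%:R * a) <= _); last first.
    by rewrite ler_wpM2l //; lra.
  have la : 0 <= a * (l%:R * a) by rewrite !mulr_ge0 // ltW.
  by rewrite -[l.+1]add1n natrD; lra.
have h4 : 4 <= (1 + a) ^+ L by apply: le_trans (bern L); lra.
apply: le_trans (_ : (1 - a) ^+ L * (1 + a) ^+ L <= _).
  by rewrite ler_wpM2l // exprn_ge0 //; lra.
rewrite -exprMn exprn_ile1 //; nra.
Qed.

Lemma absorbing_of_dense (R : realType) h (H : ordered_graph h) (c : R) M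
    (nu0 : R) : (0 < h)%N -> 0 < c -> c <= 1 -> 0 < nu0 ->
  exists (n0 : nat) (nu : R), 0 < nu /\ nu <= nu0 /\
    forall (n : nat) (G : ordered_graph n), (n0 <= n)%N ->
      dense c h (tiled H G) ->
      (forall x y, dense c M
         (fun s => tiled H G (x :: s) /\ tiled H G (y :: s))) ->
      exists Abs : {set 'I_n},
        #|Abs|%:R <= nu * n%:R /\
        forall W : {set 'I_n},
          W \subset ~: Abs -> (h %| #|W|)%N ->
          #|W|%:R <= nu ^+ 3 * n%:R -> absorbing_set H G Abs W.
Proof.
move=> h0 c0 c1 nu00; set m := (h + h * M)%N.
have m0 : (0 < m)%N by rewrite addn_gt0 h0.
pose xi : R := (c / 2) ^+ m.
have xi0 : 0 < xi by rewrite exprn_gt0 // divr_gt0.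
have xi1 : xi <= 1 by rewrite exprn_ile1 //; lra.
(* After [L] rounds the total weight has dropped by a factor 4, whereas one absorber costs a tuple
   only a factor 2. *)
have [L L0 HL] : exists2 L, (0 < L)%N & (1 - xi / 2) ^+ L * 4 <= 1.
  by apply: geometric_small; lra.
have Lm0 : 0 < (L * m)%:R :> R by rewrite ltr0n muln_gt0 L0.
have Lm1 : 1 <= (L * m)%:R :> R by rewrite ler1n muln_gt0 L0.
(* The bound [c / 8] leaves room to avoid the earlier absorbers; the last one gives
   [nu ^+ 3 <= sigma]. *)
pose nu := Num.min nu0 (Num.min (c / 8) (L * m)%:R^-1).
have nu_gt0 : 0 < nu by rewrite !lt_min nu00 divr_gt0 //= invr_gt0.
have nu_c : nu <= c / 8 by rewrite !ge_min lexx /= orbT.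
have nu_L : nu <= (L * m)%:R^-1 by rewrite !ge_min lexx /= !orbT.
(* With [s] the integer part of [sigma * n], a family of [L * s] absorbers of size [m] covers at
   most [nu * n] vertices. *)
pose sigma := nu / (L * m)%:R.
have sigma0 : 0 < sigma by rewrite divr_gt0.
have nu3 : nu ^+ 3 <= sigma.
  rewrite exprS /sigma ler_wpM2l ?(ltW nu_gt0) // expr2.
  apply: le_trans nu_L; rewrite ler_piMl ?(ltW nu_gt0) //; lra.
have [n2 Hn2] := poly_lt_exp2 h sigma0.
exists (maxn 1 (maxn n2 (Num.truncn ((h + m)%:R / (c / 8))).+1)), nu.
split=> //; split; first by rewrite ge_min lexx.
move=> n G; rewrite !geq_max => /andP [n0 /andP [nn2 nn]] hcopy hsw.
have nR : 0 < n%:R :> R by rewrite ltr0n.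
have nhm : (h + m)%:R <= c / 8 * n%:R.
  rewrite mulrC -ler_pdivrMr ?divr_gt0 //; apply: ltW.
  by apply: lt_le_trans (truncnS_gt _) _; rewrite ler_nat.
pose s := Num.truncn (sigma * n%:R).
have sn0 : 0 <= sigma * n%:R by rewrite mulr_ge0 // ltW.
have sle : s%:R <= sigma * n%:R by rewrite truncn_le.
have slt : sigma * n%:R < s.+1%:R by rewrite truncnS_gt.
have kmn : (L * s * m)%:R <= nu * n%:R.
  rewrite mulnAC natrM.
  apply: le_trans (_ : (L * m)%:R * (sigma * n%:R) <= _); first by rewrite ler_wpM2l ?(ltW Lm0).
  by rewrite mulrA /sigma mulrC [_ * (nu / _)]mulrC divfK ?gt_eqF // mulrC.
have hA (F q : seq 'I_n) : (size F <= L * s * m)%N -> size q = h -> uniq q ->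
    dense (c / 2) m (fun A => [/\ tiled H G A, tiled H G (A ++ q), uniq A
                                & ~~ has (mem F) A]).
  move=> sF sq uq; apply: dense_absorbers => //.
  have : (size F)%:R <= nu * n%:R by apply: le_trans kmn; rewrite ler_nat.
  have : nu * n%:R <= c / 8 * n%:R by rewrite ler_wpM2r // ltW.
  have cn : 0 < c * n%:R by rewrite mulr_gt0.
  by rewrite addnAC natrD; move: nhm; rewrite !natrD; lra.
have c20 : 0 <= c / 2 by lra.
have c21 : c / 2 <= 1 by lra.
have [Fm [sFm AFm uFm wFm]] := absorbing_family n0 c20 c21 hA.
have tFm A : A \in Fm -> tiled H G A by case/AFm.
have szF : size (flatten Fm) = (size Fm * m)%N.
  by apply: size_flatten_const => A /AFm [].
have many_absorbers q : size q = h -> uniq q -> (s <= count (absorbs H G q) Fm)%N.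
  move=> sq uq; rewrite leqNgt; apply/negP => lt.
  have sq' : size q == h by apply/eqP.
  (* A tuple with fewer than [s] absorbers weighs at least [2^-s], but the total weight is at most
     [n ^ h * 4^-s], which is less since [n ^ h < 2 ^ s]. *)
  have : (1 / 2) ^+ s <= n%:R ^+ h * (1 - xi / 2) ^+ (L * s) :> R.
    apply: le_trans wFm; rewrite (bigD1 (Tuple sq')) //=.
    apply: le_trans (_ : (1 / 2) ^+ count (absorbs H G q) Fm <= _).
      by rewrite ler_wiXn2l //; [lra|lra|apply: ltnW].
    by rewrite lerDl sumr_ge0 // => *; rewrite exprn_ge0; lra.
  apply/negP; rewrite -ltNge exprM.
  have rho0 : 0 <= (1 - xi / 2) ^+ L by rewrite exprn_ge0 //; lra.
  have rho4 : (1 - xi / 2) ^+ L <= 2^-1 * 2^-1 by lra.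
  apply: le_lt_trans (_ : n%:R ^+ h * (2^-1 * 2^-1) ^+ s < _).
    by rewrite ler_wpM2l ?exprn_ge0 // lerXn2r // nnegrE; lra.
  rewrite div1r exprMn mulrA gtr_pMl ?exprn_gt0 ?invr_gt0 // exprVn.
  by rewrite ltr_pdivrMr ?exprn_gt0 // mul1r -!natrX ltr_nat Hn2.
exists [set v in flatten Fm]; split.
  apply: le_trans kmn; rewrite ler_nat cardsE (leq_trans (card_size _)) //.
  by rewrite szF leq_mul2r sFm orbT.
move=> W WA hW Wn; split.
  rewrite -[flatten Fm]cats0; apply: (tiled_family (j := 0)) => //.
    by rewrite cats0.
  by rewrite muln0.
rewrite (_ : _ :|: W = [set v in flatten Fm ++ enum W]); last first.
  by apply/setP => v; rewrite !inE mem_cat mem_enum.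
apply: (tiled_family (j := (#|W| %/ h)%N)) => //.
- rewrite cat_uniq uFm enum_uniq andbT; apply/hasPn => v.
  by rewrite mem_enum => /(subsetP WA); rewrite !inE.
- by rewrite -cardE mulnC divnK.
(* The number of blocks of [W] is at most [nu ^+ 3 * n <= sigma * n], hence at most [s]. *)
move=> q sq uq; apply: leq_trans (many_absorbers q sq uq).
rewrite /s truncn_ge_nat //; apply: le_trans (_ : #|W|%:R <= _).
  by rewrite ler_nat leq_div.
by apply: le_trans Wn _; rewrite ler_wpM2r.
Qed.

(* The hypothesis 0 < h makes the interval chromatic number of H positive. *)
Theorem theorem4p1 (R : realType) (h : nat) (hpos : (0 < h)%N)
    (H : ordered_graph h) (eta : R) (eta_gt0 : 0 < eta) :
  forall nu0 : R, 0 < nu0 ->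
  exists (n0 : nat) (nu : R), 0 < nu /\ nu <= nu0 /\
    forall (n : nat) (G : ordered_graph n),
      (n0 <= n)%N ->
      (1 - 1 / (interval_chromatic_number H)%:R + eta) * n%:R
        <= (min_degree G)%:R ->
      exists Abs : {set 'I_n},
        #|Abs|%:R <= nu * n%:R /\
        forall W : {set 'I_n},
          W \subset ~: Abs ->
          (h %| #|W|)%N ->
          #|W|%:R <= nu ^+ 3 * n%:R ->
          absorbing_set H G Abs W.
Proof.
move=> nu0 nu00; have [cl [r [Hc clE r0 rchi]]] := surjective_interval_labels H hpos.
have [r1|] := ltnP 1 r; last first.
  move=> r1; have r1E : r = 1%N by lia.
  subst r; exists 0%N, nu0; do !split=> //.
  move=> n G _ _; exists set0; rewrite cards0; split.
    by rewrite mulr_ge0 // ltW.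
  move=> W _ hW _; split.
    rewrite (_ : set0 = [set v in ([::] : seq 'I_n)]); first exact: tiled_nil.
    by apply/setP => v; rewrite !inE.
  rewrite set0U (_ : W = [set v in enum W]); last first.
    by apply/setP => v; rewrite inE mem_enum.
  apply: (tiled_monochromatic G (k := (#|W| %/ h)%N) Hc clE (enum_uniq _)).
  by rewrite -cardE mulnC divnK.
(* The density lemmas take a constant that is at most 1. *)
pose e := Num.min eta 1.
have e0 : 0 < e by rewrite lt_min eta_gt0 ltr01.
have e1 : e <= 1 by rewrite ge_min lexx orbT.
have [c [M [c0 c1 [n1 sw]]]] := dense_switch r1 Hc clE e0 e1.
have [d [d0 d1 [n2 copies]]] := dense_copies r0 Hc clE e0 e1.
pose b := Num.min c d.
have b0 : 0 < b by rewrite lt_min c0.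
have bc : b <= c by rewrite ge_min lexx.
have bd : b <= d by rewrite ge_min lexx orbT.
have [n3 [nu [nu_gt0 [nu_le HA]]]] :=
  absorbing_of_dense H M hpos b0 (le_trans bc c1) nu00.
exists (maxn n1 (maxn n2 n3)), nu; do !split=> //.
move=> n G; rewrite !geq_max => /and3P [nn1 nn2 nn3] deg.
(* The degree condition weakens when the chromatic number is replaced by the smaller or equal [r],
   and [eta] by [e]. *)
have deg' : (1 - 1 / r%:R + e) * n%:R <= (min_degree G)%:R.
  apply: le_trans deg; rewrite ler_wpM2r // lerD //; last by rewrite ge_min lexx.
  rewrite lerD2l lerN2 !div1r lef_pV2 ?posrE ?ltr0n ?ler_nat //.
  exact: leq_trans rchi.
apply: HA => // [|x y].
  exact: dense_mono bd (fun _ _ => id) (copies n G nn2 deg').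
exact: dense_mono bc (fun _ _ => id) (sw n G x y nn1 deg').
Qed.
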